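(* For every $n\geq3$ there is $\alpha_n>1$ such that, if $K\subset\mathbb{R}^n$ is an $\alpha_n$-symmetric convex body (or is affinely equivalent to such a body), then $\mathfrak{I}(K)\leq2^n-1$ unless $K$ is a parallelepiped, in which case $\mathfrak{I}(K)=2^n$.
   Context: A convex body in $\mathbb{R}^n$ is a compact convex set with non-empty interior. For $\alpha\geq1$, a convex body $K\subset\mathbb{R}^n$ is called $\alpha$-symmetric if for every $x\in K$, every choice of signs $\epsilon_i\in\{\pm1\}$, $i=1,\ldots,n$, and every permutation $\pi$ of $\{1,\ldots,n\}$ we have $(\epsilon_1x_{\pi(1)},\epsilon_2x_{\pi(2)},\ldots,\epsilon_nx_{\pi(n)})\in\alpha K$. Two convex bodies are affinely equivalent if one is the image of the other under an invertible affine map of $\mathbb{R}^n$; a parallelepiped is a body affinely equivalent to $[-1,1]^n$. A direction (non-zero vector) $d$ illuminates a boundary point $x$ of a convex body $K$ if there is $\varepsilon>0$ with $x+\varepsilon d\in\operatorname{int}K$; $\mathfrak{I}(K)$ is the smallest cardinality of a set $\mathcal{D}$ of directions such that every boundary point of $K$ is illuminated by at least one $d\in\mathcal{D}$. *)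

(* Defs.v *)
From mathcomp Require Import all_boot all_order all_algebra perm.
From mathcomp Require Import all_classical all_reals all_analysis.

Set Implicit Arguments.
Unset Strict Implicit.
Unset Printing Implicit Defensive.

Import Order.TTheory GRing.Theory Num.Theory.
Import numFieldNormedType.Exports.

Local Open Scope classical_set_scope.
Local Open Scope ring_scope.

(* R^n is the space 'rV[R]_n of row vectors with its library topology, which
   comes from the sup norm and is therefore the Euclidean one. *)

Definition convex_body (R : realType) (n : nat) (K : set 'rV[R]_n) : Prop :=
  [/\ compact K, convex_set K & K° !=set0].

(* The boolean s i encodes the sign (-1) ^+ s i. *)
Definition signed_perm (R : realType) (n : nat) (s : 'I_n -> bool)
    (p : 'S_n) (x : 'rV[R]_n) : 'rV[R]_n :=
  \row_(i < n) ((-1) ^+ s i * x 0 (p i)).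

Definition alpha_symmetric (R : realType) (n : nat) (alpha : R)
    (K : set 'rV[R]_n) : Prop :=
  forall x : 'rV[R]_n, K x -> forall (s : 'I_n -> bool) (p : 'S_n),
    [set alpha *: y | y in K] (signed_perm s p x).

Definition affinely_equivalent (R : realType) (n : nat)
    (K L : set 'rV[R]_n) : Prop :=
  exists (A : 'M[R]_n) (b : 'rV[R]_n),
    A \in unitmx /\ K = [set x *m A + b | x in L].

Definition cube (R : realType) (n : nat) : set 'rV[R]_n :=
  [set x : 'rV[R]_n | forall i : 'I_n, -1 <= x 0 i <= 1].

Definition parallelepiped (R : realType) (n : nat) (K : set 'rV[R]_n) : Prop :=
  affinely_equivalent K (@cube R n).

Definition boundary (T : topologicalType) (A : set T) : set T :=
  closure A `\` A°.

Definition illuminates (R : realType) (n : nat) (K : set 'rV[R]_n)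
    (d x : 'rV[R]_n) : Prop :=
  exists2 e : R, 0 < e & K° (x + e *: d).

Definition illuminating_set (R : realType) (n : nat) (K D : set 'rV[R]_n) : Prop :=
  (forall d, D d -> d != 0) /\
  (forall x, boundary K x -> exists2 d, D d & illuminates K d x).

(* Cardinalities are taken with [counting], which is +oo on infinite sets; its
   values are natural numbers or +oo, so the infimum is a minimum as soon as K
   has some illuminating set. *)
Definition illumination_number (R : realType) (n : nat)
    (K : set 'rV[R]_n) : \bar R :=
  ereal_inf [set counting D | D in illuminating_set K].

(* Main.v *)
Require Import Defs.
From mathcomp Require Import all_boot all_order all_algebra perm.
From mathcomp Require Import all_classical all_reals all_analysis.
From mathcomp Require Import ring lra.
Set Implicit Arguments.
Unset Strict Implicit.
Unset Printing Implicit Defensive.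
Import Order.TTheory GRing.Theory Num.Theory.
Import numFieldNormedType.Exports.
Local Open Scope classical_set_scope.
Local Open Scope ring_scope.

(** Let f be an outer normal of a convex body K at x: f.y <= f.x for all y in
K. A direction d illuminates x as soon as f.d < 0 for every such f (the
boundary point x + e d would otherwise be separated from K for all small e,
and a limit of separating functionals is a normal with f.d >= 0). So
everything is a matter of controlling normals, and every condition on them is
affinely invariant. Scale K to lie in the cube [-1,1]^n and to touch it. For a
sign vector t let -t, with positive weights on its coordinates, be the
direction that points inward at the vertex t of the cube; these are 2^n
directions, and one of them must be spared when K is not a parallelepiped.
The number alpha - 1 is chosen small enough for both of the cases below.

K stays away from the cube, that is, no point of K has all coordinates above
1 - theta ([far_from_cube_spares]). If K were exactly invariant under signed
permutations, a normal f at x would have the signs of x, and |f| would be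
sorted as |x|; near invariance gives this up to a small error wherever the
coordinates of |x| are separated by a gap. Let M be the set of the large
coordinates of x, as delimited by a gap. Give each sign vector s one
coordinate of weight 1, its label, and small weights elsewhere. The direction
-s then illuminates x as soon as s agrees with x on M and the label of s lies
in M: the labelled coordinate outweighs all wrong signs off M. For n >= 3
there is a labelling for which every partial sign vector on a proper nonempty
subset extends to such an s other than (+,...,+): put the label just before a
sign change in cyclic order ([label_extension]). Only points with M everything
and all signs + remain; since their coordinates are bounded away from 1, no
single coordinate of f dominates all the others, and the direction of
(+,...,+,-,+,...,+) with a very small weight at its minus sign does the work.

K comes close to all the vertices of the cube ([near_cube_spares]); this part
uses no symmetry. Replace the cube by the circumscribed parallelepiped of
least volume. It is still close to the cube, by a stable form of the bound of
a determinant by the l1 norms of its rows, and least volume forces K to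
contain, for each j, a chord of the full length 2 in direction j
([max_det_chords]). Let theta be, up to a factor 2, the largest distance from
a vertex of the new cube to K. Suppose that 2^n - 1 directions do not suffice.
For each edge of the cube, say in direction j, try one direction for both
ends: inward in the other coordinates, and of order theta in coordinate j.
Comparing normals with the ends of the full chord shows that this can fail
only if the width of K in direction j along that edge is at least
2 - O(theta^2) ([edge_width]). So for all vertices and all j, K reaches the
facets at distance O(theta^2), within 4 theta of the vertex. This makes the
normals of K at points near a vertex almost free of wrong signs, the error
being O(theta^2) ([reach_defect]). Now take a vertex that K misses by
theta / 2: a point of K with the signs of that vertex has some coordinate i that
falls short by theta / 2, and is illuminated by the direction of the i-th
neighbour of that vertex, with weight of order theta^2 at i
([cut_vertex_spares]). So that vertex can be spared after all. If no theta > 0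
exists then K is the cube.

Finally, no two vertices of a parallelepiped can be illuminated by the same
direction, and the 2^n directions -t suffice for it. *)

(** * Linear forms and separation in row vectors *)

Definition dot (R : realType) n (f x : 'rV[R]_n) : R := \sum_i f 0 i * x 0 i.

Definition normal_at (R : realType) n (K : set 'rV[R]_n) (x f : 'rV[R]_n) : Prop :=
  forall y, K y -> dot f y <= dot f x.

(** This implies that [d] illuminates [x], see [lit_illuminates], and unlike
illumination it is visibly invariant under affine maps. *)
Definition lit (R : realType) n (K : set 'rV[R]_n) (d x : 'rV[R]_n) : Prop :=
  forall f, f != 0 -> normal_at K x f -> dot f d < 0.

Lemma dotC (R : realType) n (f x : 'rV[R]_n) : dot f x = dot x f.
Proof. by apply: eq_bigr => i _; rewrite mulrC. Qed.

Lemma dotDr (R : realType) n (f x y : 'rV[R]_n) : dot f (x + y) = dot f x + dot f y.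
Proof. by rewrite /dot -big_split; apply: eq_bigr => i _; rewrite mxE mulrDr. Qed.

Lemma dotZr (R : realType) n (f x : 'rV[R]_n) a : dot f (a *: x) = a * dot f x.
Proof. by rewrite /dot mulr_sumr; apply: eq_bigr => i _; rewrite mxE mulrCA. Qed.

Lemma dotNr (R : realType) n (f x : 'rV[R]_n) : dot f (- x) = - dot f x.
Proof. by rewrite -scaleN1r dotZr mulN1r. Qed.

Lemma dotBr (R : realType) n (f x y : 'rV[R]_n) : dot f (x - y) = dot f x - dot f y.
Proof. by rewrite dotDr dotNr. Qed.

Lemma dotDl (R : realType) n (f g x : 'rV[R]_n) : dot (f + g) x = dot f x + dot g x.
Proof. by rewrite !(dotC _ x) dotDr. Qed.

Lemma dotZl (R : realType) n (f x : 'rV[R]_n) a : dot (a *: f) x = a * dot f x.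
Proof. by rewrite !(dotC _ x) dotZr. Qed.

Lemma dotNl (R : realType) n (f x : 'rV[R]_n) : dot (- f) x = - dot f x.
Proof. by rewrite !(dotC _ x) dotNr. Qed.

Lemma dot_mulmx (R : realType) m n (f : 'rV[R]_n) (y : 'rV[R]_m) (A : 'M[R]_(m, n)) :
  dot f (y *m A) = dot (f *m A^T) y.
Proof.
rewrite /dot (eq_bigr (fun i => \sum_j f 0 i * (y 0 j * A j i))); last first.
  by move=> i _; rewrite mxE mulr_sumr.
rewrite exchange_big /=; apply: eq_bigr => j _.
by rewrite mxE mulr_suml; apply: eq_bigr => i _; rewrite mxE; ring.
Qed.

Lemma dot_gt0 (R : realType) n (f : 'rV[R]_n) : f != 0 -> 0 < dot f f.
Proof.
move=> f0; rewrite lt_neqAle eq_sym sumr_ge0 ?andbT; last first.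
  by move=> i _; rewrite -expr2 sqr_ge0.
apply: contra f0; rewrite psumr_eq0; last by move=> i _; rewrite -expr2 sqr_ge0.
move=> /allP h; apply/eqP/rowP => i; rewrite mxE.
by have /eqP/eqP := h i (mem_index_enum _); rewrite mulf_eq0 orbb => /eqP.
Qed.

Lemma sum_continuous (T : topologicalType) (R : realType) (I : finType) (F : I -> T -> R) :
  (forall i, continuous (F i)) -> continuous (fun x => \sum_i F i x).
Proof. 
move=> cF; apply: (@continuous_big R I +%R 0 predT) => //.
exact: (@pseudometric_normed_Zmodule.add_continuous R R).
Qed.

Lemma dot_continuous (R : realType) n (f : 'rV[R]_n) : continuous (dot f).
Proof.
have cF i : continuous (fun x : 'rV[R]_n => f 0 i * x 0 i).
  move=> x; apply: (@cvgM R _ (nbhs x) _ (fun=> f 0 i) (fun y : 'rV[R]_n => y 0 i)).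
    exact: cvg_cst.
  exact: coord_continuous.
exact: (sum_continuous cF).
Qed.

Lemma row_mx_norm_le (R : realType) n (x : 'rV[R]_n) (e : R) :
  0 <= e -> (`|x| <= e) <-> (forall i, `|x 0 i| <= e).
Proof.
move=> e0; rewrite [`|x|]/Num.norm /= mx_normrE; split.
  by move=> h i; apply: le_trans h; apply: (le_bigmax _ (fun ij => `|x ij.1 ij.2|) (0, i)).
move=> h; apply/bigmax_leP; split=> // -[a i] _ /=; rewrite (ord1 a); exact: h.
Qed.

Lemma coord_le_norm (R : realType) n (x : 'rV[R]_n) i : `|x 0 i| <= `|x|.
Proof. by have [h _] := row_mx_norm_le x (normr_ge0 x); exact: h. Qed.

Lemma convexE (R : realType) n (K : set 'rV[R]_n) (x y : 'rV[R]_n) (t : R) :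
  convex_set K -> K x -> K y -> 0 <= t -> t <= 1 -> K (t *: x + (1 - t) *: y).
Proof.
move=> cK Kx Ky t0 t1.
have /(_ x y (Itv01 t0 t1)) := cK; rewrite !inE /= => /(_ Kx Ky).
by [].
Qed.

(** The functional is p - z, where z is the point of C nearest to p; moving from
z towards another point of C cannot decrease the distance to first order. *)
Lemma separation (R : realType) n (C : set 'rV[R]_n) (p : 'rV[R]_n) :
  compact C -> convex_set C -> C !=set0 -> ~ C p ->
  exists f c, f != 0 /\ (forall y, C y -> dot f y <= c) /\ c < dot f p.
Proof.
move=> cC vC C0 Cp.
have cq : continuous (fun y : 'rV[R]_n => dot (y - p) (y - p)).
  suff cF i : continuous (fun y : 'rV[R]_n => (y - p) 0 i * (y - p) 0 i).
    exact: (sum_continuous cF).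
  move=> x; have h : (fun y : 'rV[R]_n => (y - p) 0 i) y @[y --> x] --> (x - p) 0 i.
    rewrite mxE; under eq_cvg do rewrite mxE.
    apply: (@cvgD R R^o _ (nbhs x) _ (fun y : 'rV[R]_n => y 0 i)).
      exact: coord_continuous.
    exact: cvg_cst.
  exact: (@cvgM R _ (nbhs x) _ _ _ _ _ h h).
have [z + zmin] := EVT_min_rV C0 cC (continuous_subspaceT cq).
rewrite inE => Cz.
have pz0 : p - z != 0.
  by apply/eqP => /eqP; rewrite subr_eq0 => /eqP pz; apply: Cp; rewrite pz.
exists (p - z), (dot (p - z) z); split=> //; split; last first.
  by rewrite -subr_gt0 -dotBr dot_gt0.
move=> y Cy; rewrite -subr_le0 -dotBr leNgt; apply/negP => pos.
set a := dot _ _ in pos; set b := dot (y - z) (y - z).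
have b0 : 0 <= b by apply: sumr_ge0 => i _; rewrite -expr2 sqr_ge0.
have key t : 0 <= t -> t <= 1 -> 2 * t * a <= t ^+ 2 * b.
  move=> t0 t1; have := zmin _ (mem_set (convexE vC Cy Cz t0 t1)).
  have -> : t *: y + (1 - t) *: z - p = t *: (y - z) - (p - z).
    by apply/rowP => i; rewrite !mxE; ring.
  have -> : z - p = - (p - z) by rewrite opprB.
  have sq u w : dot (t *: u - w) (t *: u - w)
      = t ^+ 2 * dot u u - 2 * t * dot w u + dot w w.
    by rewrite !(dotBr, dotDl, dotNl, dotZl, dotZr) (dotC w u); ring.
  by rewrite sq dotNl dotNr -/b -/a; lra.
pose t := Num.min 1 (a / (b + 1)).
have t0 : 0 < t by rewrite lt_min ltr01 divr_gt0 //; lra.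
have t1 : t <= 1 by rewrite ge_min lexx.
have := key t (ltW t0) t1.
have tb : t * (b + 1) <= a by rewrite -ler_pdivlMr ?ge_min ?lexx ?orbT //; lra.
nra.
Qed.

(** * Outer normals and illumination *)

Lemma dot_le (R : realType) n (f u : 'rV[R]_n) : `|dot f u| <= n%:R * (`|f| * `|u|).
Proof.
apply: (le_trans (ler_norm_sum _ _ _)).
rewrite -[n in n%:R]card_ord -sum1_card natr_sum mulr_suml.
apply: ler_sum => i _; rewrite mul1r normrM.
by apply: ler_pM => //; exact: coord_le_norm.
Qed.

(** Otherwise x + d/(k+1) is at distance less than 1/(k+1)^2 from a point outside
K, for every k. Normalized functionals that separate these points from K have
a cluster point f, which is a normal at x with f.d >= 0. *)
Lemma lit_illuminates (R : realType) n (K : set 'rV[R]_n) (d x : 'rV[R]_n) :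
  compact K -> convex_set K -> K x -> lit K d x -> illuminates K d x.
Proof.
move=> cK vK Kx litx; apply: contrapT => nill.
have nint (e : R) : 0 < e -> ~ K° (x + e *: d).
  by move=> e0 h; apply: nill; exists e.
pose e (k : nat) : R := k.+1%:R^-1.
have e0 k : 0 < e k by rewrite invr_gt0.
have e1 k : e k <= 1 by rewrite invf_le1 // ler1n.
have sep k : exists f : 'rV[R]_n, `|f| = 1 /\ forall y, K y ->
    dot f (y - x) <= e k * dot f d + n%:R * e k ^+ 2.
  have [z [Kz zx]] : exists z, ~ K z /\ `|z - (x + e k *: d)| < e k ^+ 2.
    apply: contrapT => /forallNP hz; apply: (nint (e k)) => //.
    apply/nbhs_ballP; exists (e k ^+ 2); first by rewrite /= exprn_gt0.
    move=> z; rewrite mx_norm_ball /= => zx; apply: contrapT => Kz.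
    by apply: (hz z); split=> //; rewrite distrC.
  have [f [c [f0 [fc cf]]]] := separation cK vK (ex_intro _ x Kx) Kz.
  have nf0 : 0 < `|f| by rewrite normr_gt0.
  exists (`|f|^-1 *: f); split.
    by rewrite normrZ normfV normr_id mulVf ?gt_eqF.
  move=> y Ky.
  have h : dot f (y - x) <= e k * dot f d + dot f (z - (x + e k *: d)).
    have := fc y Ky; rewrite !(dotBr, dotDr, dotZr); lra.
  have h2 : dot f (z - (x + e k *: d)) <= n%:R * (`|f| * e k ^+ 2).
    apply: (le_trans (ler_norm _)); apply: (le_trans (dot_le _ _)).
    by rewrite ler_wpM2l // ler_wpM2l // ltW.
  rewrite !dotZl mulrCA -[_ * _ ^+ 2](mulKf (lt0r_neq0 nf0)) -mulrDr.
  by rewrite ler_pM2l ?invr_gt0 //; lra.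
have [f_ /all_and2[fN fK]] := choice sep.
have cS : compact [set f : 'rV[R]_n | `|f| = 1].
  apply: bounded_closed_compact.
    exists 1; split; first exact: num_real.
    by move=> M M1 f /= ->; exact: ltW.
  rewrite (_ : mkset _ = (fun f : 'rV[R]_n => `|f|) @^-1` [set 1]) //.
  by apply: preimage_closed => [? _|]; [exact: norm_continuous|exact: closed_eq].
have fS : (f_ @ \oo) [set f | `|f| = 1] by exists 0%N => // k _ /=; exact: fN.
have [f [/= f1 fcl]] := cS _ _ fS.
have lim (g : 'rV[R]_n -> R) (C : R) : continuous g ->
    (forall k, g (f_ k) <= C * e k) -> g f <= 0.
  move=> cg gf; rewrite leNgt; apply/negP => gf0.
  have Ce : (fun k => C * e k) @ \oo --> C * 0.
    by apply: cvgM; [exact: cvg_cst|exact: cvg_harmonic].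
  have g2 : g f / 2 < g f by lra.
  have A1 : (f_ @ \oo) [set h | g h <= g f / 2].
    have : \forall k \near \oo, C * e k <= g f / 2.
      by apply: (cvgr_le (C * 0)) => //; rewrite mulr0 divr_gt0.
    apply: filterS => k hk /=; exact: le_trans (gf k) hk.
  have A2 : nbhs f [set h | g f / 2 < g h].
    exact: (@cvgr_gt R _ (nbhs f) _ g (g f) (cg f) _ g2).
  have [h [/= h1 h2]] := fcl _ _ A1 A2.
  by move: h1; rewrite leNgt h2.
have f0 : f != 0 by rewrite -normr_eq0 f1 oner_neq0.
have nd : 0 <= n%:R * `|d| by rewrite mulr_ge0.
have bd k : dot (f_ k) d <= n%:R * `|d|.
  by apply: (le_trans (ler_norm _)); apply: (le_trans (dot_le _ _)); rewrite fN mul1r.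
suff : 0 <= dot f d.
  rewrite leNgt => /negP; apply; apply: litx => // y Ky.
  rewrite -subr_le0 -dotBr dotC; apply: (lim _ (n%:R * `|d| + n%:R)).
    exact: dot_continuous.
  move=> k; rewrite dotC; apply: (le_trans (fK k y Ky)).
  have h1 : e k * dot (f_ k) d <= e k * (n%:R * `|d|) by rewrite ler_wpM2l // ltW.
  have h2 : n%:R * (e k * e k) <= n%:R * (e k * 1) by rewrite ler_wpM2l ?ler0n // ler_wpM2l // ltW.
  lra.
rewrite -oppr_le0 -dotNr dotC; apply: (lim _ n%:R).
  exact: dot_continuous.
move=> k; rewrite dotC dotNr.
have := fK k x Kx; rewrite dotBr subrr => h.
rewrite -(ler_pM2l (e0 k)); lra.
Qed.

(** Moving from an interior point in the direction f increases f. *)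
Lemma interior_normal0 (R : realType) n (K : set 'rV[R]_n) (z f : 'rV[R]_n) :
  K° z -> normal_at K z f -> f = 0.
Proof.
move=> /nbhs_ballP[e /= e0 eK] nf; apply/eqP; apply: contraT => f0.
have nf0 : 0 < `|f| by rewrite normr_gt0.
have : K (z + (e / 2 / `|f|) *: f).
  apply: eK; rewrite mx_norm_ball /= opprD addrA subrr sub0r normrN normrZ.
  by rewrite normrM normfV normr_id -mulrA mulVf ?gt_eqF // mulr1 ger0_norm; lra.
move=> /nf; rewrite dotDr dotZr gerDl => h.
by have := dot_gt0 f0; rewrite ltNge -(pmulr_rle0 _ (_ : 0 < e / 2 / `|f|)) ?h // !divr_gt0.
Qed.

Lemma illumination_number_le (R : realType) n (K : set 'rV[R]_n) (T : finType)
    (P : pred T) (d : T -> 'rV[R]_n) :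
  convex_body K -> (forall x, K x -> exists2 t, P t & lit K (d t) x) ->
  (illumination_number K <= #|P|%:R%:E)%E.
Proof.
move=> [cK vK _] lK.
have clK : closed K by apply: compact_closed => //; exact: norm_hausdorff.
pose D := [set d t | t in [set t | P t && (d t != 0)]].
have DI : illuminating_set K D.
  split; first by move=> _ [t /= /andP[_ dt] <-].
  move=> x [clx nix]; have Kx : K x by apply: clK.
  have [t Pt lt] := lK x Kx.
  have il := lit_illuminates cK vK Kx lt.
  exists (d t) => //; exists t => //=; rewrite Pt /=.
  by apply/eqP => d0; move: il => [e _]; rewrite d0 scaler0 addr0.
apply: (le_trans (ereal_inf_lbound _)); first by exists D.
have [t0 _|T0] := pickP (mem P); last first.
  have -> : D = set0 by rewrite predeqE => x; split => // -[t /= /andP[Pt _]]; have := T0 t; rewrite /= unfold_in Pt.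
  by rewrite /counting asboolT ?fset_set0 ?lee_fin ?ler0n.
pose g k := d (nth t0 (enum P) k).
have Dg : (D #<= `I_#|P|)%card.
  apply: (card_le_trans _ (card_image_le g `I_#|P|)).
  apply: subset_card_le => _ [t /= /andP[Pt _] <-].
  have tP : t \in enum P by rewrite mem_enum.
  by exists (index t (enum P)); rewrite /= ?cardE ?index_mem // /g nth_index.
have Df : finite_set D by apply: (card_le_finite Dg).
by rewrite /counting asboolT // lee_fin ler_nat geq_card_fset_set.
Qed.

(** * Bodies that come close to every vertex of the cube *)

(** Deleting one index from the 2^n sign vectors is a convenient way to ask for
2^n - 1 directions, because the directions used below are perturbations of the
vectors [- vtx t]. *)
Definition spares_direction (R : realType) n (K : set 'rV[R]_n) : Prop :=
  exists (t0 : {ffun 'I_n -> bool}) (d : {ffun 'I_n -> bool} -> 'rV[R]_n),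
    forall x, K x -> exists2 t, t != t0 & lit K (d t) x.

Definition vtx (R : realType) n (t : {ffun 'I_n -> bool}) : 'rV[R]_n :=
  \row_i (-1) ^+ t i.

Definition sgn (R : realType) n (x : 'rV[R]_n) : {ffun 'I_n -> bool} :=
  [ffun i => x 0 i < 0].

Definition in_cube (R : realType) n (K : set 'rV[R]_n) : Prop :=
  forall x, K x -> forall i, `|x 0 i| <= 1.

Definition near_cube (R : realType) n (K : set 'rV[R]_n) (th : R) : Prop :=
  forall t : {ffun 'I_n -> bool},
    exists2 y, K y & forall i, 1 - th <= (-1) ^+ t i * y 0 i.

Lemma signM_norm (R : realType) (a : R) : (-1) ^+ (a < 0)%R * a = `|a|.
Proof. by rewrite -normrEsign ?num_real. Qed.

Lemma mul_sign_norm (R : realType) (a : R) : a = (-1) ^+ (a < 0)%R * `|a|.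
Proof. by rewrite -realEsign ?num_real. Qed.

Lemma norm_sign (R : realType) (b : bool) (a : R) : `|(-1) ^+ b * a| = `|a|.
Proof. by rewrite normrM normrX normrN1 expr1n mul1r. Qed.

Lemma sign_le_norm (R : realType) (b : bool) (a : R) : (-1) ^+ b * a <= `|a|.
Proof. by rewrite -(norm_sign b) ler_norm. Qed.

Lemma norm1_gt0 (R : realType) n (f : 'rV[R]_n) : f != 0 -> 0 < \sum_i `|f 0 i|.
Proof.
move=> f0; rewrite lt_neqAle eq_sym sumr_ge0 ?andbT //.
apply: contra f0; rewrite psumr_eq0 //.
move=> /allP h; apply/eqP/rowP => i; rewrite mxE; apply/eqP.
by rewrite -normr_eq0; exact: h (mem_index_enum _).
Qed.

Lemma normalZ (R : realType) n (K : set 'rV[R]_n) (x f : 'rV[R]_n) a :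
  0 <= a -> normal_at K x f -> normal_at K x (a *: f).
Proof. by move=> a0 nf y Ky; rewrite !dotZl ler_wpM2l ?nf. Qed.

Lemma lit_norm1 (R : realType) n (K : set 'rV[R]_n) (d x : 'rV[R]_n) :
  (forall f : 'rV[R]_n, \sum_i `|f 0 i| = 1 -> normal_at K x f -> dot f d < 0) -> lit K d x.
Proof.
move=> h f /norm1_gt0 f0 nf.
have := h ((\sum_i `|f 0 i|)^-1 *: f).
rewrite dotZl pmulr_rlt0 ?invr_gt0 //; apply; last by apply: normalZ => //; rewrite invr_ge0 ltW.
rewrite -[RHS](mulVf (lt0r_neq0 f0)) mulr_sumr; apply: eq_bigr => i _.
by rewrite mxE normrM ger0_norm // invr_ge0 ltW.
Qed.

(** How much x loses in coordinate i against the vertex of the cube at which f is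
largest: [dot_defect]. For points of the cube these losses are nonnegative,
and for a normal of a body close to the cube they are small in total. *)
Definition defect (R : realType) n (f x : 'rV[R]_n) (i : 'I_n) : R :=
  `|f 0 i| * (1 - (-1) ^+ (f 0 i < 0)%R * x 0 i).

Lemma defect_ge0 (R : realType) n (f x : 'rV[R]_n) i :
  `|x 0 i| <= 1 -> 0 <= defect f x i.
Proof.
by move=> xi; rewrite mulr_ge0 // subr_ge0 (le_trans (sign_le_norm _ _)).
Qed.

Lemma dot_defect (R : realType) n (f x : 'rV[R]_n) :
  dot f x = \sum_i `|f 0 i| - \sum_i defect f x i.
Proof.
rewrite -sumrB; apply: eq_bigr => i _.
rewrite /defect {1}(mul_sign_norm (f 0 i)); ring.
Qed.

(** K has a point close to the vertex of the cube with the signs of f. *)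
Lemma normal_defect (R : realType) n (K : set 'rV[R]_n) th (x f : 'rV[R]_n) :
  near_cube K th -> normal_at K x f ->
  \sum_i defect f x i <= th * \sum_i `|f 0 i|.
Proof.
move=> nK nf; have [y Ky yP] := nK (sgn f).
have := nf y Ky; rewrite (dot_defect f x) => h.
suff : (1 - th) * \sum_i `|f 0 i| <= dot f y by lra.
rewrite mulr_sumr; apply: ler_sum => i _.
have := yP i; rewrite ffunE => h2.
by rewrite {2}(mul_sign_norm (f 0 i)) mulrAC ler_wpM2r.
Qed.

Lemma defect_le (R : realType) n (K : set 'rV[R]_n) th (x f : 'rV[R]_n) i :
  in_cube K -> near_cube K th -> K x -> normal_at K x f ->
  defect f x i <= th * \sum_i `|f 0 i|.
Proof.
move=> bK nK Kx nf; apply: le_trans (normal_defect nK nf).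
rewrite (bigD1 i) //= lerDl sumr_ge0 // => k _; apply: defect_ge0; exact: bK.
Qed.

(** If f and x have opposite signs at i then the defect is at least |f_i|. *)
Lemma sgn_defect (R : realType) n (f x : 'rV[R]_n) i :
  `|x 0 i| <= 1 -> `|f 0 i| - 2 * defect f x i <= (-1) ^+ (x 0 i < 0)%R * f 0 i.
Proof.
rewrite ler_norml /defect => /andP[x1 x2].
case: (ltrP (f 0 i) 0) => hf; case: (ltrP (x 0 i) 0) => hx;
  rewrite ?(ltr0_norm hf) ?(ger0_norm hf) ?expr0 ?expr1; nra.
Qed.

(** By [sgn_defect] a normal has nearly all of its l1 norm on coordinates where it
has the sign of x. *)
Lemma lit_sgn (R : realType) n (K : set 'rV[R]_n) th (x : 'rV[R]_n) :
  in_cube K -> near_cube K th -> th < 1 / 2 -> K x -> lit K (- vtx R (sgn x)) x.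
Proof.
move=> bK nK th2 Kx; apply: lit_norm1 => f f1 nf.
rewrite dotNr oppr_lt0.
have h1 := normal_defect nK nf; rewrite f1 mulr1 in h1.
apply: (@lt_le_trans _ _ (\sum_i (`|f 0 i| - 2 * defect f x i))).
  by rewrite sumrB -mulr_sumr f1; lra.
apply: ler_sum => i _; rewrite !mxE !ffunE mulrC [leRHS]mulrC mulrC; apply: sgn_defect; exact: bK.
Qed.

Definition flip n (t : {ffun 'I_n -> bool}) (i : 'I_n) : {ffun 'I_n -> bool} :=
  [ffun k => if k == i then ~~ t i else t k].

(** If |x_i| is not close to 1 then the coordinate i of a normal is small, so the
sign chosen there does not matter. This leaves a choice of direction at every
point that is not near a vertex. *)
Lemma lit_flip (R : realType) n (K : set 'rV[R]_n) th (x : 'rV[R]_n) i :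
  in_cube K -> near_cube K th -> 0 < th -> th < 1 / 8 -> K x ->
  `|x 0 i| <= 1 - 4 * th -> lit K (- vtx R (flip (sgn x) i)) x.
Proof.
move=> bK nK th0 th2 Kx xi; apply: lit_norm1 => f f1 nf.
rewrite dotNr oppr_lt0.
have h1 := normal_defect nK nf; rewrite f1 mulr1 in h1.
have := defect_le i bK nK Kx nf; rewrite f1 mulr1 => h2.
have fi : `|f 0 i| <= 1 / 4.
  have : `|f 0 i| * (4 * th) <= th.
    apply: le_trans h2; rewrite ler_wpM2l // lerBrDl -lerBrDr.
    exact: le_trans (sign_le_norm _ _) xi.
  by move=> h; rewrite -(ler_pM2r th0); lra.
apply: (@lt_le_trans _ _ (\sum_k (`|f 0 k| - 2 * defect f x k) - 2 * `|f 0 i|)).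
  by rewrite sumrB -mulr_sumr f1; lra.
rewrite /dot [leRHS](bigD1 i) //= (bigD1 i) //= -addrA [X in _ + X]addrC addrA.
apply: lerD.
  rewrite !mxE !ffunE eqxx.
  have := sign_le_norm (~~ (x 0 i < 0)) (- f 0 i); rewrite normrN mulrC => h3.
  have h4 := defect_ge0 f (bK _ Kx i).
  have := normr_ge0 (f 0 i); lra.
apply: ler_sum => k ki; rewrite !mxE !ffunE (negbTE ki) [leRHS]mulrC.
apply: sgn_defect; exact: bK.
Qed.

(** * Affine invariance, and the case of a parallelepiped *)

Lemma affine_sym (R : realType) n (K L : set 'rV[R]_n) :
  affinely_equivalent K L -> affinely_equivalent L K.
Proof.
move=> [A [b [uA ->]]]; exists (invmx A), (- b *m invmx A); split.
  by rewrite unitmx_inv.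
rewrite predeqE => x; split.
  move=> Lx; exists (x *m A + b); first by exists x.
  by rewrite -mulmxDl addrK mulmxK.
by move=> [_ [y Ly <-] <-]; rewrite -mulmxDl addrK mulmxK.
Qed.

Lemma affine_trans (R : realType) n (K L M : set 'rV[R]_n) :
  affinely_equivalent K L -> affinely_equivalent L M -> affinely_equivalent K M.
Proof.
move=> [A [b [uA ->]]] [B [c [uB ->]]]; exists (B *m A), (c *m A + b); split.
  by rewrite unitmx_mul uB.
rewrite predeqE => x; split.
  move=> [_ [y My <-] <-]; exists y => //.
  by rewrite mulmxDl mulmxA addrA.
move=> [y My <-]; exists (y *m B + c); first by exists y.
by rewrite mulmxDl mulmxA addrA.
Qed.

Lemma normal_affine (R : realType) n (L : set 'rV[R]_n) (A : 'M[R]_n) b y f :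
  normal_at [set x *m A + b | x in L] (y *m A + b) f -> normal_at L y (f *m A^T).
Proof.
move=> nf z Lz; have /nf : [set x *m A + b | x in L] (z *m A + b) by exists z.
by rewrite !dotDr lerD2r !dot_mulmx.
Qed.

Lemma lit_affine (R : realType) n (L : set 'rV[R]_n) (A : 'M[R]_n) b d y :
  A \in unitmx -> lit L d y -> lit [set x *m A + b | x in L] (d *m A) (y *m A + b).
Proof.
move=> uA ly f f0 /normal_affine nf; rewrite dot_mulmx; apply: ly => //.
apply: contra f0 => /eqP fA.
by rewrite -(mulmxK (_ : A^T \in unitmx) f) ?fA ?mul0mx // unitmx_tr.
Qed.

Lemma spares_direction_affine (R : realType) n (K L : set 'rV[R]_n) :
  affinely_equivalent K L -> spares_direction L -> spares_direction K.
Proof.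
move=> [A [b [uA ->]]] [t0 [d dL]]; exists t0, (fun t => d t *m A).
move=> _ [y Ly <-]; have [t tt0 ly] := dL y Ly.
by exists t => //; exact: lit_affine.
Qed.

Lemma spares_direction_number (R : realType) n (K : set 'rV[R]_n) :
  convex_body K -> spares_direction K -> (illumination_number K <= (2 ^+ n - 1)%:E)%E.
Proof.
move=> cK [t0 [d dK]].
have := illumination_number_le (P := fun t => t != t0) cK dK.
rewrite (_ : #|_| = (2 ^ n).-1); last first.
  rewrite (eq_card (B := predC (pred1 t0))) // cardC1 card_ffun card_bool card_ord //.
move=> h; apply: (le_trans h); rewrite lee_fin -subn1 natrB ?expn_gt0 //.
by rewrite natrX.
Qed.

Lemma cube_near (R : realType) n : near_cube (@cube R n) 0.
Proof.
move=> t; exists (vtx R t) => [i|i]; rewrite mxE.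
  by case: (t i); rewrite ?expr0 ?expr1; apply/andP; split; lra.
by rewrite -expr2 sqrr_sign subr0.
Qed.

Lemma cube_in_cube (R : realType) n : in_cube (@cube R n).
Proof. by move=> x cx i; rewrite ler_norml; exact: cx. Qed.

Lemma parallelepiped_number_le (R : realType) n (K : set 'rV[R]_n) :
  convex_body K -> parallelepiped K -> (illumination_number K <= (2 ^+ n)%:E)%E.
Proof.
move=> cK [A [b [uA KE]]].
pose d t : 'rV[R]_n := - vtx R t *m A.
have dK x : K x -> exists2 t : {ffun 'I_n -> bool}, predT t & lit K (d t) x.
  rewrite KE => -[y cy <-]; exists (sgn y) => //; apply: lit_affine => //.
  apply: (lit_sgn (@cube_in_cube R n) (@cube_near R n)) => //; lra.
apply: (le_trans (illumination_number_le cK dK)).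
by rewrite lee_fin cardT -cardE card_ffun card_bool card_ord natrX.
Qed.

(** A direction that illuminates the vertex t has, in the coordinates of the
parallelepiped, the sign opposite to t in every coordinate, so it determines
t. *)
Lemma parallelepiped_number_ge (R : realType) n (K : set 'rV[R]_n) :
  (0 < n)%N -> parallelepiped K -> ((2 ^+ n)%:E <= illumination_number K)%E.
Proof.
move=> n0 [A [b [uA KE]]].
apply: le_ereal_inf_tmp => _ [D [D0 DK] <-].
pose v t : 'rV[R]_n := vtx R t *m A + b.
have Kv t : K (v t).
  rewrite KE; exists (vtx R t) => // i; rewrite mxE.
  by case: (t i); rewrite ?expr0 ?expr1; apply/andP; split; lra.
pose f (t : {ffun 'I_n -> bool}) (i : 'I_n) : 'rV[R]_n := ((-1) ^+ t i *: 'e_i) *m (invmx A)^T.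
have dotf t i z : dot (f t i) (z *m A) = (-1) ^+ t i * z 0 i.
  rewrite /f -dot_mulmx mulmxK // dotZl /dot (bigD1 i) //= big1 ?addr0.
    by rewrite !mxE !eqxx mul1r.
  by move=> k ki; rewrite !mxE eqxx (negbTE ki) /= mul0r.
have nf t i : normal_at K (v t) (f t i).
  rewrite /normal_at KE => _ [z cz <-]; rewrite !dotDr lerD2r !dotf mxE -expr2 sqrr_sign.
  by have := cube_in_cube cz i; apply: le_trans; exact: sign_le_norm.
have f0 t i : f t i != 0.
  apply/eqP => h; have := dotf t i (vtx R t); rewrite h mxE -expr2 sqrr_sign /dot big1.
    by move/esym/eqP; rewrite oner_eq0.
  by move=> k _; rewrite mxE mul0r.
have int_neg t z e i : 0 < e -> K° (v t + e *: z) -> dot (f t i) z < 0.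
  move=> e0 iz; rewrite ltNge; apply/negP => h; move: (f0 t i); apply/negP; rewrite negbK.
  apply/eqP; apply: (interior_normal0 iz) => y Ky; apply: (le_trans (nf t i y Ky)).
  by rewrite [leRHS]dotDr lerDl dotZr mulr_ge0 // ltW.
have bv t : boundary K (v t).
  split; first exact: subset_closure.
  move=> iv; have := @int_neg t 0 1 (Ordinal n0) ltr01.
  by rewrite scaler0 addr0 dotC /dot big1 ?ltxx => [/(_ iv)//|k _]; rewrite mxE mul0r.
have ill (t : {ffun 'I_n -> bool}) : exists z : 'rV[R]_n, D z /\ forall i, (-1) ^+ t i * (z *m invmx A) 0 i < 0.
  have [z Dz [e e0 iz]] := DK _ (bv t); exists z; split=> // i.
  by rewrite -dotf mulmxKV //; exact: int_neg iz.
have [g /all_and2[gD gN]] := choice ill.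
have ginj : injective g.
  move=> t t' tt'; apply/ffunP => i; have := gN t i; rewrite tt'; have := gN t' i.
  by case: (t i); case: (t' i); rewrite ?expr0 ?expr1 //; lra.
rewrite /counting; case: ifPn => [/asboolP Df|_]; last exact: leey.
rewrite lee_fin -natrX ler_nat; apply: leq_card_fset_set => //.
pose N := #|{: {ffun 'I_n -> bool}}|.
have N2 : N = (2 ^ n)%N by rewrite /N card_ffun card_bool card_ord.
pose t0 : {ffun 'I_n -> bool} := [ffun=> false].
pose h k := g (nth t0 (enum {: {ffun 'I_n -> bool}}) k).
have hinj : {in `I_(2 ^ n)%N &, injective h}.
  move=> k l; rewrite !inE /= -N2 /N cardE => hk hl /ginj /eqP.
  by rewrite nth_uniq ?enum_uniq // => /eqP.
have /card_eqPle[_ le1] := inj_card_eq hinj.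
by apply: (card_le_trans le1); apply: subset_card_le => _ [k _ <-]; exact: gD.
Qed.

(** * One direction for both ends of an edge *)

Definition near_edge (R : realType) n (s : {ffun 'I_n -> bool}) (j : 'I_n) (th : R)
    (x : 'rV[R]_n) : Prop :=
  forall i, i != j -> 1 - 4 * th <= (-1) ^+ s i * x 0 i.

(** Off j this points from the vertices s towards the reference point o. *)
Definition edge_dir (R : realType) n (s : {ffun 'I_n -> bool}) (j : 'I_n)
    (o : 'rV[R]_n) (h : R) : 'rV[R]_n :=
  \row_i (if i == j then h else o 0 i - (-1) ^+ s i).

Lemma near_edge_dist (R : realType) n (s : {ffun 'I_n -> bool}) j (th : R) (x : 'rV[R]_n) i :
  near_edge s j th x -> i != j -> `|x 0 i| <= 1 -> `|x 0 i - (-1) ^+ s i| <= 4 * th.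
Proof.
move=> nx ij; have := nx i ij; rewrite !ler_norml.
by case: (s i); rewrite ?expr0 ?expr1 => h1 /andP[h2 h3]; apply/andP; split; lra.
Qed.

(** The constants: the l1 norm of f off j is at most 12 theta, because
0 <= f.d <= - (1/2) (that norm) + 2 theta + 4 theta, the last two terms coming
from h and from the defects. Hence f is nearly + or - the j-th coordinate form.
Compare f at x and at [op] (or [om]): off j, replacing x - op by s - o costs
12 theta * 8 theta = 96 theta^2, and the result is bounded by the hypothesis on
f.d; dividing by |f_j| >= 1/2 doubles the error. *)
Lemma edge_unlit (R : realType) n (K : set 'rV[R]_n) th (s : {ffun 'I_n -> bool}) j (o op om x f : 'rV[R]_n) h :
  in_cube K -> near_cube K th -> 0 < th -> 20 * (20 * th) <= 1 ->
  K op -> K om -> K x -> near_edge s j th x ->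
  (forall i, i != j -> `|o 0 i| <= 1 /\ (-1) ^+ s i * o 0 i <= 1 / 2) ->
  (forall i, i != j -> `|op 0 i - o 0 i| <= 4 * th /\ `|om 0 i - o 0 i| <= 4 * th) ->
  `|h| <= 2 * th ->
  \sum_i `|f 0 i| = 1 -> normal_at K x f -> 0 <= dot f (edge_dir s j o h) ->
  op 0 j - x 0 j <= h + 192 * th ^+ 2 \/ x 0 j - om 0 j <= - h + 192 * th ^+ 2.
Proof.
move=> bK nK th0 th1 Kop Kom Kx nx oP opP hh f1 nf fd.
pose S := \sum_(i | i != j) `|f 0 i|.
have fS : `|f 0 j| + S = 1 by rewrite -f1 [RHS](bigD1 j).
have S0 : 0 <= S by apply: sumr_ge0.
pose V := \sum_(i | i != j) f 0 i * (o 0 i - (-1) ^+ s i).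
have fV : 0 <= f 0 j * h + V.
  move: fd; rewrite /dot (bigD1 j) //= mxE eqxx; congr (_ <= _ + _).
  by apply: eq_bigr => i ij; rewrite mxE (negbTE ij).
have fh : f 0 j * h <= `|f 0 j| * (2 * th).
  apply: (le_trans (ler_norm _)); rewrite normrM; exact: ler_wpM2l.
have dfs : \sum_(i | i != j) defect f x i <= th.
  have := normal_defect nK nf; rewrite f1 mulr1 (bigD1 j) //=.
  have := defect_ge0 f (bK x Kx j); lra.
have V1 : V <= - (1 / 2) * S + 4 * \sum_(i | i != j) defect f x i.
  rewrite /V /S !mulr_sumr -big_split /=; apply: ler_sum => i ij.
  have [oi1 oi2] := oP i ij.
  have d0 := defect_ge0 f (bK x Kx i).
  have sx : (x 0 i < 0) = s i.
    have := nx i ij; case: (s i); rewrite ?expr0 ?expr1 => hx.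
      by apply/idP; lra.
    by apply/negbTE; rewrite -leNgt; lra.
  have := sgn_defect f (bK x Kx i); rewrite sx.
  set e := defect f x i in d0 *. move: oi1; rewrite ler_norml => /andP[p1 p2].
  have := normr_ge0 (f 0 i).
  move: oi2; case: (s i); rewrite ?expr0 ?expr1 => oi2 a0 h1; nra.
have fj1 : `|f 0 j| <= 1 by lra.
have S12 : S <= 12 * th by nra.
have fj2 : 1 / 2 <= `|f 0 j| by lra.
have side (q : 'rV[R]_n) : (forall i, i != j -> `|q 0 i - o 0 i| <= 4 * th) -> K q ->
    f 0 j * (q 0 j - x 0 j - h) <= 96 * th ^+ 2.
  move=> qP Kq.
  have : \sum_(i | i != j) f 0 i * (x 0 i - q 0 i) <= - V + 8 * th * S.
    rewrite /V /S mulr_sumr -sumrN -big_split /=; apply: ler_sum => i ij.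
    have a1 := near_edge_dist nx ij (bK x Kx i).
    have a2 := qP i ij.
    have : `|f 0 i * ((x 0 i - (-1) ^+ s i) - (q 0 i - o 0 i))| <= `|f 0 i| * (8 * th).
      rewrite normrM ler_wpM2l // (le_trans (ler_normB _ _)) //; lra.
    move=> /(le_trans (ler_norm _)); lra.
  have := nf q Kq; rewrite /dot [leLHS](bigD1 j) //= [leRHS](bigD1 j) //=.
  have -> : \sum_(i | i != j) f 0 i * (x 0 i - q 0 i) =
    \sum_(i | i != j) f 0 i * x 0 i - \sum_(i | i != j) f 0 i * q 0 i.
    by rewrite -sumrB; apply: eq_bigr => i _; rewrite mulrBr.
  have : 8 * th * S <= 96 * th ^+ 2 by nra.
  lra.
have [fj|fj] := ltrP (f 0 j) 0; [right|left].
  have := side om (fun i ij => (opP i ij).2) Kom; rewrite ltr0_norm // in fj2; nra.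
have := side op (fun i ij => (opP i ij).1) Kop; rewrite ger0_norm // in fj2; nra.
Qed.

Definition set_sign n (s : {ffun 'I_n -> bool}) (j : 'I_n) (b : bool) : {ffun 'I_n -> bool} :=
  [ffun i => if i == j then b else s i].

(** Every point of K that is not near the edge is illuminated by one of the
directions of the other vertices. So if the family that uses [edge_dir] at one
end of the edge and nothing at the other end fails, it fails at a point near
the edge. *)
Lemma edge_merge (R : realType) n (K : set 'rV[R]_n) th (s : {ffun 'I_n -> bool}) j (o op om : 'rV[R]_n) h :
  in_cube K -> near_cube K th -> 0 < th -> 20 * (20 * th) <= 1 -> ~ spares_direction K ->
  K op -> K om ->
  (forall i, i != j -> `|o 0 i| <= 1 /\ (-1) ^+ s i * o 0 i <= 1 / 2) ->
  (forall i, i != j -> `|op 0 i - o 0 i| <= 4 * th /\ `|om 0 i - o 0 i| <= 4 * th) ->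
  `|h| <= 2 * th ->
  exists x, [/\ K x, near_edge s j th x &
  op 0 j - x 0 j <= h + 192 * th ^+ 2 \/ x 0 j - om 0 j <= - h + 192 * th ^+ 2].
Proof.
move=> bK nK th0 th1 nill Kop Kom oP opP hh.
pose t0 := set_sign s j true; pose t1 := set_sign s j false.
pose d (t : {ffun 'I_n -> bool}) : 'rV[R]_n := if t == t1 then edge_dir s j o h else - vtx R t.
have t10 : t1 != t0 by apply/eqP => /ffunP/(_ j); rewrite !ffunE eqxx.
have [x [Kx nlx]] : exists x, K x /\ forall t, t != t0 -> ~ lit K (d t) x.
  apply: contrapT => nx; apply: nill; exists t0, d => x Kx; apply: contrapT => nl.
  by apply: nx; exists x; split=> // t tt0 lt; apply: nl; exists t.
have dN t : t != t1 -> d t = - vtx R t by rewrite /d => /negbTE ->.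
have sx i : i != j -> sgn x i = s i.
  move=> ij; apply/eqP; apply: contraT => si.
  have xt b : sgn x != set_sign s j b.
    by apply: contra si => /eqP ->; rewrite ffunE (negbTE ij).
  have /(_ _ (xt true)) := nlx; case.
  by rewrite dN ?xt //; apply: (lit_sgn bK nK) => //; lra.
have nx : near_edge s j th x.
  move=> i ij; rewrite leNgt; apply/negP => hi.
  have xi : `|x 0 i| <= 1 - 4 * th.
    by rewrite -signM_norm; have := sx i ij; rewrite ffunE => ->; exact: ltW.
  have xt b : flip (sgn x) i != set_sign s j b.
    apply/eqP => /ffunP/(_ i); rewrite !ffunE eqxx (negbTE ij) -(sx i ij) ffunE.
    by case: (_ < _).
  have /(_ _ (xt true)) := nlx; case.
  by rewrite dN ?xt //; apply: (lit_flip bK nK) => //; lra.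
exists x; split=> //.
have /(_ _ t10) := nlx; rewrite /d eqxx => nl.
apply: contrapT => nor; apply: nl; apply: lit_norm1 => f f1 nf.
rewrite ltNge; apply/negP => fd; apply: nor.
exact: (edge_unlit bK nK th0 th1 Kop Kom Kx nx oP opP hh f1 nf fd).
Qed.

(** [h] is chosen just large enough that [edge_merge] cannot produce a point on the
side of [op], whose height would exceed the supremum a. It produces a point on
the side of [om], which is then low. The error 386 is 2 * 193, where
193 = 192 + 1, the 1 being spent on the approximation of the supremum. *)
Lemma edge_width (R : realType) n (K : set 'rV[R]_n) th (s : {ffun 'I_n -> bool}) j (o op om : 'rV[R]_n) :
  in_cube K -> near_cube K th -> 0 < th -> 20 * (20 * th) <= 1 -> ~ spares_direction K ->
  K op -> K om ->
  (forall i, i != j -> `|o 0 i| <= 1 /\ (-1) ^+ s i * o 0 i <= 1 / 2) ->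
  (forall i, i != j -> `|op 0 i - o 0 i| <= 4 * th /\ `|om 0 i - o 0 i| <= 4 * th) ->
  1 - th <= op 0 j ->
  exists y y', [/\ K y, K y', near_edge s j th y, near_edge s j th y' &
    op 0 j - om 0 j - 386 * th ^+ 2 <= y 0 j - y' 0 j].
Proof.
move=> bK nK th0 th1 nill Kop Kom oP opP opj.
pose A := [set x 0 j | x in [set x | K x /\ near_edge s j th x]].
have [y0 Ky0 y0P] := nK (set_sign s j false).
have Ay0 : A (y0 0 j).
  exists y0 => //; split=> // i ij; have := y0P i; rewrite ffunE (negbTE ij); lra.
have y0j : 1 - th <= y0 0 j by have := y0P j; rewrite ffunE eqxx expr0 mul1r.
have ubA : ubound A 1.
  by move=> _ [x [Kx _] <-]; apply: le_trans (bK x Kx j); exact: ler_norm.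
have sA : has_sup A by split; [exists (y0 0 j)|exists 1].
pose a := sup A.
have a1 : a <= 1 by apply: ge_sup => //; exists (y0 0 j).
have a2 : 1 - th <= a by apply: (le_trans y0j); exact: sup_upper_bound.
have op1 := bK op Kop j.
have op2 : op 0 j <= 1 by apply: le_trans op1; exact: ler_norm.
have th2 : 0 < th ^+ 2 by rewrite exprn_gt0.
have hh : `|op 0 j - a - 193 * th ^+ 2| <= 2 * th.
  have : 193 * th ^+ 2 <= th by rewrite expr2 mulrA -[leRHS]mul1r ler_pM2r //; lra.
  by rewrite ler_norml => ?; apply/andP; split; lra.
have [x [Kx nx xP]] := edge_merge bK nK th0 th1 nill Kop Kom oP opP hh.
have [_ [y [Ky ny] <-] ya] := sup_adherent th2 sA.
have xa : x 0 j <= a by apply: sup_upper_bound => //; exists x.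
exists y, x; split=> //.
rewrite -/a in ya; case: xP; lra.
Qed.

(** * A body that misses a vertex of the cube *)

Lemma flip_inj n (t : {ffun 'I_n -> bool}) i k : flip t i = flip t k -> i = k.
Proof.
move=> /ffunP/(_ i); rewrite !ffunE eqxx; case: eqVneq => // _.
by case: (t i).
Qed.

Lemma flip_neq n (t : {ffun 'I_n -> bool}) i : flip t i != t.
Proof. by apply/eqP => /ffunP/(_ i); rewrite ffunE eqxx; case: (t i). Qed.

(** Near every vertex K comes to within C theta^2 of each facet, but at points that
depend on the facet: a cube with a corner cut off at depth theta is allowed. *)
Definition edges_reach (R : realType) n (K : set 'rV[R]_n) (C th : R) : Prop :=
  forall (s : {ffun 'I_n -> bool}) j, exists y,
    [/\ K y, near_edge s j th y & 1 - C * th ^+ 2 <= (-1) ^+ s j * y 0 j].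

(** Testing a normal that nearly is the i-th coordinate form against the point of
[edges_reach] at the facet i improves the bound theta of [normal_defect] to
order theta^2. *)
Lemma reach_defect (R : realType) n (K : set 'rV[R]_n) C th (x f : 'rV[R]_n) i :
  0 <= C -> 0 < th -> edges_reach K C th -> normal_at K x f -> \sum_k `|f 0 k| = 1 ->
  \sum_(k | k != i) `|f 0 k| <= 3 * th -> \sum_k defect f x k <= (C + 12) * th ^+ 2.
Proof.
move=> C0 th0 rK nf f1 S3; have [y [Ky ny yi]] := rK (sgn f) i.
have := nf y Ky; rewrite (dot_defect f x) (dot_defect f y) => h.
suff : \sum_k defect f y k <= (C + 12) * th ^+ 2 by lra.
rewrite (bigD1 i) //=.
have fi : `|f 0 i| <= 1.
  by rewrite -f1 (bigD1 i) //= lerDl sumr_ge0.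
have a1 : defect f y i <= C * th ^+ 2.
  rewrite ffunE in yi; rewrite /defect.
  have D0 : 0 <= C * th ^+ 2 by rewrite mulr_ge0 // exprn_ge0 // ltW.
  have h1 : 1 - (-1) ^+ (f 0 i < 0)%R * y 0 i <= C * th ^+ 2 by lra.
  apply: (le_trans (ler_wpM2l (normr_ge0 (f 0 i)) h1)).
  by rewrite -[leRHS]mul1r ler_wpM2r.
have a2 : \sum_(k | k != i) defect f y k <= 4 * th * \sum_(k | k != i) `|f 0 k|.
  rewrite mulr_sumr; apply: ler_sum => k ki; rewrite /defect mulrC ler_wpM2r //.
  by have := ny k ki; rewrite ffunE; lra.
have : 4 * th * \sum_(k | k != i) `|f 0 k| <= 4 * th * (3 * th) by rewrite ler_wpM2l //; lra.
lra.
Qed.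

(** The vertex s is spared. The direction of its neighbour in coordinate i gets the
small weight eta at i: it still illuminates what it has to, by [reach_defect],
and it illuminates the points with the signs of s that fall short in coordinate
i, for a normal concentrated at i would have a defect of order theta there. *)
Lemma cut_vertex_spares (R : realType) n (K : set 'rV[R]_n) C th (s : {ffun 'I_n -> bool}) :
  in_cube K -> near_cube K th -> 0 <= C -> 0 < th -> 8 * ((C + 12) * th) <= 1 ->
  edges_reach K C th ->
  (forall y, K y -> exists i, (-1) ^+ s i * y 0 i < 1 - th / 2) -> spares_direction K.
Proof.
move=> bK nK C0 th0 th1 rK cut.
have th8 : 96 * th <= 1 by have := mulr_ge0 C0 (ltW th0); lra.
have [D [DE D0 D8]] : exists D : R, [/\ D = (C + 12) * th ^+ 2, 0 < D & 8 * D <= th].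
  exists ((C + 12) * th ^+ 2); split=> //.
    by rewrite mulr_gt0 ?exprn_gt0 //; lra.
  by rewrite expr2 !mulrA -[leRHS]mul1r ler_pM2r // -mulrA.
(* At a coordinate of f of size close to 1/2 or larger, eta has to beat the wrong
   signs, which amount to at most 2 D. *)
have [eta etaE] : exists eta : R, eta = 8 * D by exists (8 * D).
have eta0 : 0 < eta by lra.
pose w (t : {ffun 'I_n -> bool}) k : R := if t == flip s k then eta else 1.
pose d (t : {ffun 'I_n -> bool}) : 'rV[R]_n := \row_k (- ((-1) ^+ t k * w t k)).
have dflip f i : dot f (d (flip s i)) =
    - (eta * ((-1) ^+ flip s i i * f 0 i)) - \sum_(k | k != i) (-1) ^+ s k * f 0 k.
  rewrite /dot (bigD1 i) //= mxE /w eqxx; congr (_ + _); first by ring.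
  rewrite -sumrN; apply: eq_bigr => k ki; rewrite mxE /w.
  rewrite (_ : (flip s i == flip s k) = false); last first.
    by apply/negbTE; apply: contra ki => /eqP/flip_inj ->.
  by rewrite ffunE (negbTE ki); ring.
have small (x f : 'rV[R]_n) i : K x -> \sum_k `|f 0 k| = 1 -> normal_at K x f ->
    (forall k, k != i -> sgn x k = s k) -> 0 <= dot f (d (flip s i)) ->
    [/\ \sum_k defect f x k <= D, 1 / 2 <= `|f 0 i| &
     - (2 * \sum_(k | k != i) defect f x k) <= \sum_(k | k != i) (-1) ^+ s k * f 0 k].
  move=> Kx f1 nf xs fd.
  pose S := \sum_(k | k != i) `|f 0 k|.
  have fS : `|f 0 i| + S = 1 by rewrite -f1 [RHS](bigD1 i).
  have S0 : 0 <= S by apply: sumr_ge0.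
  have h1 : S - 2 * \sum_(k | k != i) defect f x k <= \sum_(k | k != i) (-1) ^+ s k * f 0 k.
    rewrite mulr_sumr -sumrB; apply: ler_sum => k ki.
    by have := sgn_defect f (bK x Kx k); have := xs k ki; rewrite ffunE => ->.
  have dfs : \sum_(k | k != i) defect f x k <= th.
    have := normal_defect nK nf; rewrite f1 mulr1 (bigD1 i) //=.
    have := defect_ge0 f (bK x Kx i); lra.
  have h2 : - (eta * ((-1) ^+ flip s i i * f 0 i)) <= eta.
    rewrite -mulrN -[leRHS]mulr1 ler_pM2l //.
    apply: (le_trans (ler_norm _)); rewrite normrN norm_sign; lra.
  have S3 : S <= 3 * th by rewrite dflip in fd; lra.
  by split; [rewrite DE; exact: (reach_defect C0 th0 rK nf f1 S3)|lra|lra].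
exists s, d => x Kx.
have [xs|xs] := eqVneq (sgn x) s.
  have [i xi] := cut x Kx; exists (flip s i); first exact: flip_neq.
  apply: lit_norm1 => f f1 nf; rewrite ltNge; apply/negP => fd.
  (* A defect of order theta contradicts the bound D of order theta^2. *)
  have [D1 fi _] := small x f i Kx f1 nf (fun k _ => congr1 (fun g : {ffun _ -> _} => g k) xs) fd.
  have : th / 4 <= \sum_k defect f x k.
    rewrite (bigD1 i) //=; apply: (@le_trans _ _ (defect f x i)); last first.
      by rewrite lerDl sumr_ge0 // => k _; apply: defect_ge0; exact: bK.
    have : (-1) ^+ (f 0 i < 0)%R * x 0 i <= 1 - th / 2.
      apply: (le_trans (sign_le_norm _ _)); rewrite -signM_norm.
      by have /ffunP/(_ i) := xs; rewrite ffunE => ->; exact: ltW.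
    rewrite /defect; nra.
  lra.
have [[i xi]|xn] := pselect (exists i, sgn x = flip s i).
  exists (sgn x) => //; rewrite xi.
  apply: lit_norm1 => f f1 nf; rewrite ltNge; apply/negP => fd.
  have xk k : k != i -> sgn x k = s k by move=> ki; rewrite xi ffunE (negbTE ki).
  have [D1 fi h1] := small x f i Kx f1 nf xk fd.
  have := sgn_defect f (bK x Kx i); have /ffunP/(_ i) := xi; rewrite ffunE => -> h2.
  have d0 k : 0 <= defect f x k by apply: defect_ge0; exact: bK.
  rewrite dflip in fd; rewrite (bigD1 i) //= in D1.
  have d1 : 0 <= \sum_(k | k != i) defect f x k by apply: sumr_ge0.
  have d2 := d0 i.
  set A := (-1) ^+ flip s i i * f 0 i in fd h2 *.
  have A1 : 9 / 20 <= A.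
    lra.
  have : eta * (9 / 20) <= eta * A by rewrite ler_pM2l.
  lra.
exists (sgn x) => //.
have -> : d (sgn x) = - vtx R (sgn x).
  apply/rowP => k; rewrite !mxE /w; case: eqP => [xk|_]; last by rewrite mulr1.
  by case: xn; exists k.
by apply: (lit_sgn bK nK) => //; lra.
Qed.

(** * Bodies close to the cube with a full chord in every coordinate direction *)

Definition has_chords (R : realType) n (K : set 'rV[R]_n) : Prop :=
  forall j, exists p : 'rV[R]_n, K p /\ K (p + 2 *: 'e_j).

(** The chord alone is a reference for [edge_width] only at the vertices s1 opposite
to it. The width found there, averaged with the chord, gives a reference whose
coordinates off j are at most 1/2, and this one serves every edge in direction
j. Averaging halves the first error 386, the second one is added to it. *)
Lemma chords_edges_reach (R : realType) n (K : set 'rV[R]_n) (th : R) :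
  convex_set K -> in_cube K -> near_cube K th -> 0 < th -> 20 * (20 * th) <= 1 -> ~ spares_direction K ->
  has_chords K -> edges_reach K (386 + 386 / 2) th.
Proof.
move=> vK bK nK th0 th1 nill cK s j.
have [D [DE E2 D0 Dth]] : exists D : R, [/\ forall u, u - 386 * th ^+ 2 = u - D,
    forall u, u - (386 + 386 / 2) * th ^+ 2 = u - (D + D / 2), 0 < D & D <= th].
  have th2 : 0 < th ^+ 2 by rewrite exprn_gt0.
  have : 20 * (20 * (th ^+ 2)) <= th.
    by rewrite expr2 !mulrA -[leRHS]mul1r ler_pM2r //; lra.
  by exists (386 * th ^+ 2); split=> [u|u||]; lra.
have [p [Kp Kp2]] := cK j.
have pe i : (p + 2 *: 'e_j) 0 i = p 0 i + 2 * (i == j)%:R by rewrite !mxE.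
have hp1 : 1 <= (p + 2 *: 'e_j) 0 j.
  have := bK p Kp j; rewrite pe eqxx ler_norml => /andP[h _]; rewrite mulr1; lra.
pose s1 : {ffun 'I_n -> bool} := [ffun i => ~~ (p 0 i < 0)].
have s1p i : (-1) ^+ s1 i * p 0 i = - `|p 0 i|.
  by rewrite -signM_norm ffunE; case: (_ < _); rewrite ?expr0 ?expr1; lra.
have [y [y' [Ky Ky' ny ny' yy']]] : exists y y', [/\ K y, K y',
    near_edge s1 j th y, near_edge s1 j th y' & 2 - D <= y 0 j - y' 0 j].
  have h1 : 1 - th <= (p + 2 *: 'e_j) 0 j by lra.
  have h2 i : i != j -> `|p 0 i| <= 1 /\ (-1) ^+ s1 i * p 0 i <= 1 / 2.
    move=> _; split; first exact: bK.
    by rewrite s1p; have := normr_ge0 (p 0 i); lra.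
  have h3 i : i != j -> `|(p + 2 *: 'e_j) 0 i - p 0 i| <= 4 * th /\ `|p 0 i - p 0 i| <= 4 * th.
    by move=> ij; rewrite pe (negbTE ij) mulr0 addr0 subrr normr0; split; lra.
  have [y [y' [Ky Ky' ny ny' yy']]] := edge_width bK nK th0 th1 nill Kp2 Kp h2 h3 h1.
  exists y, y'; split=> //; move: yy'; rewrite DE pe eqxx mulr1; lra.
have mid u v : K u -> K v -> K ((1 / 2) *: u + (1 / 2) *: v).
  move=> Ku Kv; have := @convexE _ _ K u v (1 / 2) vK Ku Kv.
  by rewrite (_ : 1 - 1 / 2 = 1 / 2 :> R); [apply; lra|lra].
have midE (u v : 'rV[R]_n) i : ((1 / 2) *: u + (1 / 2) *: v) 0 i = 1 / 2 * u 0 i + 1 / 2 * v 0 i.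
  by rewrite !mxE.
have [z [z' [Kz Kz' nz nz' zz']]] : exists z z', [/\ K z, K z',
    near_edge s j th z, near_edge s j th z' & 2 - D / 2 - D <= z 0 j - z' 0 j].
  pose o := (1 / 2) *: p + (1 / 2) *: vtx R s1.
  have h1 : 1 - th <= ((1 / 2) *: (p + 2 *: 'e_j) + (1 / 2) *: y) 0 j.
    have := bK y' Ky' j; rewrite midE ler_norml => /andP[h _]; lra.
  have h2 i : i != j -> `|o 0 i| <= 1 /\ (-1) ^+ s i * o 0 i <= 1 / 2.
    move=> _; have oi : `|o 0 i| <= 1 / 2.
      have := bK p Kp i; have := s1p i; rewrite midE !mxE.
      have := normr_ge0 (p 0 i); rewrite !ler_norml.
      by case: (s1 i); rewrite ?expr0 ?expr1 => ? ? /andP[? ?]; apply/andP; split; lra.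
    by split; [lra|apply: le_trans oi; exact: sign_le_norm].
  have h3 i : i != j -> `|((1 / 2) *: (p + 2 *: 'e_j) + (1 / 2) *: y) 0 i - o 0 i| <= 4 * th
      /\ `|((1 / 2) *: p + (1 / 2) *: y') 0 i - o 0 i| <= 4 * th.
    move=> ij.
    have := near_edge_dist ny ij (bK y Ky i); have := near_edge_dist ny' ij (bK y' Ky' i).
    have half (u v w : R) : `|1 / 2 * u + 1 / 2 * v - (1 / 2 * u + 1 / 2 * w)| = 1 / 2 * `|v - w|.
      by rewrite opprD addrACA subrr add0r -mulrBr normrM ger0_norm ?divr_ge0.
    by rewrite !midE pe (negbTE ij) mulr0 addr0 mxE !half => h4 h5; split; lra.
  have [z [z' [Kz Kz' nz nz' zz']]] :=
    edge_width bK nK th0 th1 nill (mid _ _ Kp2 Ky) (mid _ _ Kp Ky') h2 h3 h1.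
  exists z, z'; split=> //; move: zz'; rewrite DE !midE pe eqxx mulr1; lra.
have := bK z Kz j; have := bK z' Kz' j; rewrite !ler_norml => /andP[? ?] /andP[? ?].
by case sj: (s j); [exists z'|exists z]; split=> //; rewrite E2 ?sj ?expr0 ?expr1; lra.
Qed.

(** A functional that separates a point of the cube from K would also be larger at
a vertex of the cube than on K. *)
Lemma near_all_cube (R : realType) n (K : set 'rV[R]_n) (a : R) :
  compact K -> convex_set K -> 0 < a -> (forall k : nat, near_cube K (a / 2 ^+ k)) ->
  @cube R n `<=` K.
Proof.
move=> cK vK a0 nK z cz; apply: contrapT => Kz.
have K0 : K !=set0 by have [y Ky _] := nK 0%N [ffun=> false]; exists y.
have [f [c [f0 [fc cf]]]] := separation cK vK K0 Kz.
pose F := \sum_i `|f 0 i|.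
have F0 : 0 < F by exact: norm1_gt0.
have zF : dot f z <= F.
  rewrite dot_defect gerBl; apply: sumr_ge0 => i _; apply: defect_ge0; exact: cube_in_cube.
have cF k : (1 - a / 2 ^+ k) * F <= c.
  have [y Ky yP] := nK k (sgn f); apply: le_trans (fc y Ky).
  rewrite mulr_sumr; apply: ler_sum => i _; have := yP i; rewrite ffunE => h.
  by rewrite {2}(mul_sign_norm (f 0 i)) mulrAC ler_wpM2r.
pose e := (dot f z - c) / (a * F).
have e0 : 0 < e by rewrite divr_gt0 ?mulr_gt0 // subr_gt0.
have [k ke] : exists k : nat, (2 ^+ k)^-1 < e.
  exists (Num.bound e^-1); rewrite invf_plt ?posrE ?exprn_gt0 //.
  have h1 : e^-1 < (Num.bound e^-1)%:R by apply: archi_boundP; rewrite invr_ge0 ltW.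
  apply: (lt_le_trans h1); rewrite -natrX ler_nat; apply: ltnW; exact: ltn_expl.
have := cF k; rewrite leNgt => /negP; apply.
move: ke; rewrite ltr_pdivlMr ?mulr_gt0 // => h; have := zF; lra.
Qed.

(** Halve the scale for as long as K reaches all vertices at that scale. *)
Lemma near_scale (R : realType) n (K : set 'rV[R]_n) (a : R) :
  compact K -> convex_set K -> in_cube K -> 0 < a -> near_cube K a -> K <> @cube R n ->
  exists th (s : {ffun 'I_n -> bool}), [/\ 0 < th, th <= a, near_cube K th &
    forall y, K y -> exists i, (-1) ^+ s i * y 0 i < 1 - th / 2 ] .
Proof.
move=> cK vK bK a0 nKa Kc.
have [k] : exists k : nat, `[< ~ near_cube K (a / 2 ^+ k) >].
  apply: contrapT => /forallNP h; apply: Kc; rewrite predeqE => x; split.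
    by move=> Kx i; rewrite -ler_norml; exact: bK.
  apply: (near_all_cube cK vK a0) => k; apply: contrapT => nk.
  by apply: (h k); apply/asboolP.
move=> hk; have := ex_intro (fun k : nat => `[< ~ near_cube K (a / 2 ^+ k) >]) k hk.
move=> /ex_minnP[[|m] /asboolP nm mmin]; first by case: nm; rewrite expr0 divr1.
have nm' : near_cube K (a / 2 ^+ m).
  apply: contrapT => h; have /mmin : `[< ~ near_cube K (a / 2 ^+ m) >] by apply/asboolP.
  by rewrite ltnn.
have m0 : 0 < a / 2 ^+ m by rewrite divr_gt0 ?exprn_gt0.
have /existsNP[s hs] := nm.
exists (a / 2 ^+ m), s; split=> //.
  by rewrite ler_pdivrMr ?exprn_gt0 // ler_peMr ?(ltW a0) // -natrX ler1n expn_gt0.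
move=> y Ky; apply: contrapT => h; apply: hs; exists y => // i.
rewrite leNgt; apply/negP => h2; apply: h; exists i; apply: (lt_le_trans h2).
by rewrite lerD2l lerN2 exprSr invfM mulrA.
Qed.

Lemma chords_spares (R : realType) n (K : set 'rV[R]_n) (a : R) :
  compact K -> convex_set K -> in_cube K -> 0 < a -> near_cube K a ->
  8 * ((386 + 386 / 2 + 12) * a) <= 1 -> has_chords K -> K <> @cube R n -> spares_direction K.
Proof.
move=> cK vK bK a0 nKa a1 hK Kc; apply: contrapT => nill; apply: (nill).
have [th [s [th0 tha nK cut]]] := near_scale cK vK bK a0 nKa Kc.
have mono (k : R) : 0 <= k -> 8 * (k * a) <= 1 -> 8 * (k * th) <= 1.
  by move=> k0; apply: le_trans; rewrite ler_wpM2l // ler_wpM2l.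
have th1 : 8 * ((386 + 386 / 2 + 12) * th) <= 1 by apply: mono a1; lra.
apply: (cut_vertex_spares bK nK _ th0 th1 _ cut); first lra.
apply: chords_edges_reach => //; lra.
Qed.

(** * Continuity and compactness for matrices and differences of sets *)

(** The entries may live in any topological space, so that a matrix can be treated
as a row vector of its rows. *)
Lemma entry_continuous (T : topologicalType) m n (i : 'I_m) (j : 'I_n) :
  continuous (fun M : 'M[T]_(m, n) => M i j).
Proof.
move=> M P nP; exists (fun k l => if (k == i) && (l == j) then P else setT).
  by move=> k l; case: ifPn => [/andP[/eqP -> /eqP ->] //|_]; exact: filterT.
by move=> N /= /(_ i j); rewrite !eqxx.
Qed.

Lemma det_rows_continuous (R : realType) n :
  continuous (fun v : 'rV['rV[R]_n]_n => \det (\matrix_(i < n, j < n) (v 0 i) 0 j)).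
Proof.
have c1 i j : continuous (fun v : 'rV['rV[R]_n]_n => (v 0 i) 0 j).
  move=> v; apply: (@continuous_comp _ _ _ (fun v : 'rV['rV[R]_n]_n => v 0 i)
    (fun u : 'rV[R]_n => u 0 j)).
    exact: entry_continuous.
  exact: coord_continuous.
have c2 (s : 'S_n) : continuous (fun v : 'rV['rV[R]_n]_n =>
    (-1) ^+ s * \prod_i (v 0 i) 0 (s i)).
  move=> v; apply: (@cvgM R _ (nbhs v) _ (fun=> (-1) ^+ s)); first exact: cvg_cst.
  apply: (@continuous_big R 'I_n *%R 1 predT) => //.
  exact: mul_continuous.
rewrite (_ : (fun v => _) = fun v : 'rV['rV[R]_n]_n => \sum_(s : 'S_n) (-1) ^+ s * \prod_i (v 0 i) 0 (s i)).
  exact: (sum_continuous c2).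
by apply/funext => v; apply: eq_bigr => s _; congr (_ * _); apply: eq_bigr => i _; rewrite mxE.
Qed.

Lemma mulmx_continuous (R : realType) m n (A : 'M[R]_(m, n)) (b : 'rV[R]_n) :
  continuous (fun x : 'rV[R]_m => x *m A + b).
Proof.
have c1 i : continuous (fun x : 'rV[R]_m => x 0 i *: row i A).
  move=> x; apply: (@cvgZr_tmp R _ _ (nbhs x) _ (fun x : 'rV[R]_m => x 0 i)).
  exact: coord_continuous.
move=> x; apply: (@cvgD _ _ _ (nbhs x) _ (fun x : 'rV[R]_m => x *m A) (fun=> b)); last exact: cvg_cst.
rewrite (_ : (fun x => _) = fun x : 'rV[R]_m => \sum_i x 0 i *: row i A); last first.
  by apply/funext => y; rewrite mulmx_sum_row.
rewrite mulmx_sum_row.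
apply: (@continuous_big 'rV[R]_n 'I_m +%R 0 predT) => //.
exact: pseudometric_normed_Zmodule.add_continuous.
Qed.

Lemma affine_compact (R : realType) n (K : set 'rV[R]_n) (A : 'M[R]_n) b :
  compact K -> compact [set x *m A + b | x in K].
Proof.
move=> cK; apply: continuous_compact => //.
by apply: continuous_subspaceT; exact: mulmx_continuous.
Qed.

Lemma affine_convex (R : realType) n (K : set 'rV[R]_n) (A : 'M[R]_n) b :
  convex_set K -> convex_set [set x *m A + b | x in K].
Proof.
move=> vK x y l; rewrite !inE => -[u Ku <-] [v Kv <-].
exists (conv l (u : convex_lmodType 'rV[R]_n) (v : convex_lmodType 'rV[R]_n)).
  by have := vK u v l; rewrite !inE; apply.
rewrite /conv /= mulmxDl -!scalemxAl !scalerDr addrACA; congr (_ + _).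
by rewrite -scalerDl /unstable.onem addrCA subrr addr0 scale1r.
Qed.

Lemma diff_compact (R : realType) n (K : set 'rV[R]_n) :
  compact K -> compact [set u.1 - u.2 | u in K `*` K].
Proof.
move=> cK; apply: continuous_compact; last exact: compact_setX.
apply: continuous_subspaceT => u.
apply: (@cvgB _ _ _ (nbhs u) _ (fun u : 'rV[R]_n * 'rV[R]_n => u.1) (fun u => u.2)).
  exact: cvg_fst.
exact: cvg_snd.
Qed.

Lemma diff_convex (R : realType) n (K : set 'rV[R]_n) :
  convex_set K -> convex_set [set u.1 - u.2 | u in K `*` K].
Proof.
move=> vK x y l; rewrite !inE => -[[u u'] /= [Ku Ku'] <-] [[v v'] /= [Kv Kv'] <-].
exists (conv l (u : convex_lmodType 'rV[R]_n) (v : convex_lmodType 'rV[R]_n),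
        conv l (u' : convex_lmodType 'rV[R]_n) (v' : convex_lmodType 'rV[R]_n)) => /=.
  by split; [have := vK u v l|have := vK u' v' l]; rewrite !inE; apply.
by rewrite /conv /= !scalerBr opprD addrACA.
Qed.

(** * The circumscribed parallelepiped of least volume *)

(** The linear forms f such that K lies in a slab {x | |f.x + c| <= 1}. *)
Definition width_le2 (R : realType) n (K : set 'rV[R]_n) (f : 'rV[R]_n) : Prop :=
  forall y y', K y -> K y' -> dot f y - dot f y' <= 2.

(** K has points close to opposite vertices of the cube, at which f is nearly its l1
norm and minus its l1 norm. *)
Lemma width_norm1 (R : realType) n (K : set 'rV[R]_n) th (f : 'rV[R]_n) :
  near_cube K th -> width_le2 K f -> (1 - th) * \sum_i `|f 0 i| <= 1.
Proof.
move=> nK wf.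
have [y Ky yP] := nK (sgn f).
have [z Kz zP] := nK [ffun i => ~~ (sgn f i)].
have := wf y z Ky Kz.
suff : 2 * ((1 - th) * \sum_i `|f 0 i|) <= dot f y - dot f z by lra.
rewrite !mulr_sumr -sumrB; apply: ler_sum => i _.
have := yP i; have := zP i; rewrite !ffunE => hz hy.
rewrite {2 3}(mul_sign_norm (f 0 i)).
have := normr_ge0 (f 0 i).
by move: hy hz; case: (f 0 i < 0); rewrite /= ?expr0 ?expr1 => hy hz h; nra.
Qed.

(** Forms f_1, ..., f_n of width at most 2 define a parallelepiped around K of
volume 2^n / |det|; the maximum is attained since these forms make a compact
set. *)
Lemma max_det (R : realType) n (K : set 'rV[R]_n) th :
  in_cube K -> near_cube K th -> th <= 1 / 2 ->
  exists F : 'M[R]_n, [/\ forall i, width_le2 K (row i F), 1 <= \det F &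
    forall G : 'M[R]_n, (forall i, width_le2 K (row i G)) -> \det G <= \det F].
Proof.
move=> bK nK th2.
have cW : compact (width_le2 K).
  apply: bounded_closed_compact.
    exists 2; split; first exact: num_real.
    move=> M M2 f /= wf; apply: ltW; apply: le_lt_trans M2.
    apply/row_mx_norm_le => // i.
    have := width_norm1 nK wf; have : `|f 0 i| <= \sum_i `|f 0 i|.
      by rewrite (bigD1 i) //= lerDl sumr_ge0.
    by have := normr_ge0 (f 0 i); nra.
  rewrite (_ : width_le2 K = \bigcap_(u in K `*` K) (dot (u.1 - u.2) @^-1` [set r | r <= 2])).
    apply: closed_bigI => u _; apply: preimage_closed => [? _|]; last exact: closed_le.
    exact: dot_continuous.
  rewrite predeqE => f; split.
    by move=> wf [u v] /= [Ku Kv]; rewrite dotC dotBr; exact: wf.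
  by move=> h u v Ku Kv; have := h (u, v) (conj Ku Kv); rewrite /= dotC dotBr.
pose S := [set v : 'rV['rV[R]_n]_n | forall i, width_le2 K (v ord0 i)].
have cS : compact S by exact: (@rV_compact 'rV[R]_n n (fun=> width_le2 K)).
pose v1 : 'rV['rV[R]_n]_n := \row_i (row i 1%:M).
have wdelta i : width_le2 K (row i 1%:M).
  have dE z : dot (row i 1%:M) z = z 0 i.
    rewrite /dot (bigD1 i) //= big1 ?addr0 => [|k ki]; rewrite !mxE ?eqxx ?mul1r //.
    by rewrite eq_sym (negbTE ki) mul0r.
  move=> y y' Ky Ky'; rewrite !dE.
  have := bK y Ky i; have := bK y' Ky' i; rewrite !ler_norml => /andP[? ?] /andP[? ?]; lra.
have S0 : S !=set0 by exists v1 => i; rewrite mxE.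
have [v vS vmax] := compact_EVT_max S0 cS (continuous_subspaceT (@det_rows_continuous R n)).
rewrite inE in vS.
have rowE (u : 'rV['rV[R]_n]_n) i : row i (\matrix_(i < n, j < n) (u 0 i) 0 j) = u 0 i.
  by apply/rowP => j; rewrite !mxE.
have maxG (G : 'M[R]_n) : (forall i, width_le2 K (row i G)) ->
    \det G <= \det (\matrix_(i < n, j < n) (v 0 i) 0 j).
  move=> wG; have := vmax (\row_i row i G).
  rewrite inE => /(_ (fun i => _)); rewrite (_ : \matrix_(i, j) _ = G).
    by apply => i; rewrite mxE.
  by apply/matrixP => i j; rewrite !mxE.
exists (\matrix_(i < n, j < n) (v 0 i) 0 j); split=> //.
  by move=> i; rewrite rowE; exact: vS.
by rewrite -(det1 R n); exact: maxG.
Qed.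

(** Expand the product of the row sums over all maps of the indices to themselves.
The permanent collects the bijections, which all take the value j, and the
product of the row sums without column j collects the maps that avoid j. So if
the permanent is close to the largest possible value 1 then the latter product
is small, hence one of its factors is: that row is nearly concentrated at j. *)
Lemma permanent_stable (R : realType) n (b : 'I_n -> 'I_n -> R) (kap : R) j :
  (forall i k, 0 <= b i k) -> (forall i, \sum_k b i k <= 1) -> 0 < kap -> kap <= 1 ->
  1 - kap ^+ n < \sum_(s : 'S_n) \prod_i b i (s i) ->
  exists i, \sum_(k | k != j) b i k < kap /\ 1 - 2 * kap <= b i j.
Proof.
move=> b0 b1 k0 k1 hs.
have injE : \sum_(s : 'S_n) \prod_i b i (s i) =
    \sum_(f : {ffun 'I_n -> 'I_n} | injectiveb f) \prod_i b i (f i).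
  rewrite (reindex (@pval _)) /=; last first.
    pose in_Sn := insubd (1%g : 'S_n).
    by exists in_Sn => /= f Uf; first apply: val_inj; apply: insubdK.
  by apply: eq_big => [s|s _]; [rewrite (valP s)|apply: eq_bigr => i _; rewrite pvalE].
have full : \prod_i \sum_k b i k = \sum_(f : {ffun 'I_n -> 'I_n}) \prod_i b i (f i).
  exact: bigA_distr_bigA.
have avoid : \prod_i \sum_(k | k != j) b i k =
    \sum_(f : {ffun 'I_n -> 'I_n} | f \in ffun_on (fun k => k != j)) \prod_i b i (f i).
  exact: bigA_distr_big.
have full1 : \prod_i \sum_k b i k <= 1.
  by apply: prodr_ile1 => i _; rewrite sumr_ge0 //=.
have split_full : \sum_(s : 'S_n) \prod_i b i (s i) + \prod_i \sum_(k | k != j) b i k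
    <= \prod_i \sum_k b i k.
  rewrite injE avoid full [leRHS](bigID (fun f : {ffun 'I_n -> 'I_n} => injectiveb f)) /=.
  rewrite lerD2l big_mkcond [leRHS]big_mkcond /=; apply: ler_sum => f _.
  have P0 : 0 <= \prod_i b i (f i) by apply: prodr_ge0.
  case: ifPn => [fj|_]; last by case: ifP.
  rewrite ifT //; apply/negP => /injectiveP finj.
  have /codomP[i ji] : j \in codom f by apply: inj_card_onto.
  by have /ffun_onP/(_ i) := fj; rewrite unfold_in -ji eqxx.
have [i hi] : exists i, \sum_(k | k != j) b i k < kap.
  apply: contrapT => /forallNP h.
  have : \prod_(i < n) kap <= \prod_i \sum_(k | k != j) b i k.
    apply: ler_prod => i _; rewrite (ltW k0) /= leNgt; apply/negP; exact: h.
  have gen (u p q r : R) : 1 - u < p -> p + q <= r -> r <= 1 -> ~ (u <= q).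
    by clear; lra.
  rewrite prodr_const card_ord; exact: gen hs split_full full1.
exists i; split=> //.
have kn : kap ^+ n <= kap.
  have : (0 < n)%N by apply: leq_ltn_trans (ltn_ord j).
  by case: (n) => [//|m] _; rewrite exprS ler_piMr ?(ltW k0) // exprn_ile1 ?(ltW k0).
have inj0 : 0 <= \prod_i \sum_(k | k != j) b i k.
  by apply: prodr_ge0 => l _; exact: sumr_ge0.
have : \prod_l \sum_k b l k <= \sum_k b i k.
  rewrite (bigD1 i) //= ler_piMr ?sumr_ge0 //.
  by apply: prodr_ile1 => l _; rewrite sumr_ge0 //=.
have gen (u p q r v w : R) : 1 - u < p -> p + q <= r -> 0 <= q -> u <= kap ->
    w < kap -> r <= v + w -> 1 - 2 * kap <= v.
  by clear; lra.
by rewrite [X in _ <= X](bigD1 j) //=; exact: gen hs split_full inj0 kn hi.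
Qed.

Lemma det_replace_row (R : realType) n (F : 'M[R]_n) (h : 'rV[R]_n) i :
  \det (\matrix_(k, l) if k == i then (h *m F) 0 l else F k l) = h 0 i * \det F.
Proof.
set G := \matrix_(k, l) _.
have cof l : cofactor G i l = cofactor F i l.
  rewrite /cofactor; congr (_ * \det _); apply/matrixP => a b.
  by rewrite !mxE eq_sym (negbTE (neq_lift _ _)).
rewrite (expand_det_row G i).
transitivity ((h *m F *m \adj F) 0 i).
  by rewrite [RHS]mxE; apply: eq_bigr => l _; rewrite cof {1}/G mxE eqxx [X in _ = _ * X]mxE.
by rewrite -mulmxA mul_mx_adj mul_mx_scalar mxE mulrC.
Qed.

(** If 2 e_i is not a difference of two points of the transformed body, a form
separates it from these differences. Scaled to width 2, this form has i-th
coordinate larger than 1, and putting it in the place of the i-th coordinate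
form would increase the determinant. *)
Lemma max_det_chords (R : realType) n (K : set 'rV[R]_n) (F : 'M[R]_n) c :
  compact K -> convex_set K -> K !=set0 ->
  (forall i, width_le2 K (row i F)) -> 1 <= \det F ->
  (forall G : 'M[R]_n, (forall i, width_le2 K (row i G)) -> \det G <= \det F) ->
  has_chords [set x *m F^T + c | x in K].
Proof.
move=> cK vK [x0 Kx0] wF dF maxF i; apply: contrapT => nch.
pose K' := [set x *m F^T + c | x in K].
have cK' : compact K' by exact: affine_compact.
have vK' : convex_set K' by exact: affine_convex.
pose D := [set u.1 - u.2 | u in K' `*` K'].
have K'x x : K x -> K' (x *m F^T + c) by move=> Kx; exists x.
have D0 : D 0.
  exists (x0 *m F^T + c, x0 *m F^T + c); last by rewrite /= subrr.
  by split; exact: K'x.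
have nD : ~ D (2 *: 'e_i).
  move=> [[u v] /= [Ku Kv] uv]; apply: nch; exists v; split=> //.
  by rewrite -uv addrCA subrr addr0.
have [g [c0 [_ [gc cg]]]] := separation (diff_compact cK') (diff_convex vK') (ex_intro _ 0 D0) nD.
have c00 : 0 <= c0.
  by have := gc _ D0; rewrite /dot big1 // => k _; rewrite mxE mulr0.
have gi : dot g (2 *: 'e_i) = 2 * g 0 i.
  rewrite dotZr /dot (bigD1 i) //= big1 ?addr0; first by rewrite mxE !eqxx mulr1.
  by move=> k ki; rewrite mxE eqxx (negbTE ki) mulr0.
rewrite gi in cg.
pose m := (c0 + 2 * g 0 i) / 2.
have m0 : 0 < m by rewrite /m; lra.
pose h := (2 / m) *: g.
have hi : 1 < h 0 i by rewrite mxE mulrAC ltr_pdivlMr // mul1r /m; lra.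
have := maxF (\matrix_(k, l) if k == i then (h *m F) 0 l else F k l).
rewrite det_replace_row leNgt => /(_ _)/negP; apply; last first.
  by rewrite -[ltLHS]mul1r ltr_pM2r // (lt_le_trans ltr01).
move=> k; have [->|ki] := eqVneq k i; last first.
  rewrite (_ : row k _ = row k F) //; apply/rowP => l; by rewrite !mxE (negbTE ki).
rewrite (_ : row i _ = h *m F); last by apply/rowP => l; rewrite !mxE eqxx.
move=> y y' Ky Ky'; rewrite -[F]trmxK -!dot_mulmx.
have : D ((y *m F^T + c) - (y' *m F^T + c)).
  by exists (y *m F^T + c, y' *m F^T + c) => //; split; exact: K'x.
move=> /gc; rewrite dotBr !dotDr opprD addrACA subrr addr0 => hg.
rewrite -dotBr dotZl dotBr mulrAC ler_pdivrMr // ler_pM2l // /m; lra.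
Qed.

Lemma inj_ord_onto n (f : 'I_n -> 'I_n) i : injective f -> exists j, f j = i.
Proof.
move=> finj; have /codomP[j ->] : i \in codom f by exact: inj_card_onto.
by exists j.
Qed.

(** By [permanent_stable] the coordinate forms of the parallelepiped of least volume
are, up to small errors, those of the cube in another order and with other
signs. So the new body is close to the vertices of its new cube. *)
Lemma chords_position (R : realType) n (K : set 'rV[R]_n) (th kap : R) :
  compact K -> convex_set K -> in_cube K -> near_cube K th ->
  0 < kap -> kap < 1 / 8 -> 0 <= th -> th <= 1 / 2 -> n%:R * th < kap ^+ n ->
  exists (A : 'M[R]_n) c, A \in unitmx /\
    let K' := [set x *m A + c | x in K] in
    [/\ in_cube K', near_cube K' (8 * kap) & has_chords K'].
Proof.
move=> cK vK bK nK k0 k8 th0 th2 thk.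
have [F [wF dF maxF]] := max_det bK nK th2.
have K0 : K !=set0 by have [y Ky _] := nK [ffun=> false]; exists y.
have ex_c i : exists c : R, forall y, K y -> `|dot (row i F) y + c| <= 1.
  pose A := [set dot (row i F) y | y in K].
  have [x0 Kx0] := K0.
  have ubA : ubound A (2 + dot (row i F) x0).
    by move=> _ [y Ky <-]; rewrite -lerBlDr; exact: wF.
  have sA : has_sup A by split; [exists (dot (row i F) x0); exists x0|exists (2 + dot (row i F) x0)].
  exists (1 - sup A) => y Ky; rewrite ler_norml; apply/andP; split; last first.
    have : dot (row i F) y <= sup A by apply: sup_upper_bound => //; exists y.
    lra.
  have : sup A <= 2 + dot (row i F) y.
    apply: ge_sup; first by exists (dot (row i F) x0); exists x0.
    by move=> _ [z Kz <-]; have := wF i z y Kz Ky; lra.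
  lra.
have [c cP] := choice ex_c.
pose cv : 'rV[R]_n := \row_i c i.
have phiE x i : (x *m F^T + cv) 0 i = dot (row i F) x + c i.
  rewrite !mxE; congr (_ + _); apply: eq_bigr => k _; by rewrite !mxE mulrC.
exists F^T, cv; split.
  by rewrite unitmx_tr unitmxE unitfE gt_eqF // (lt_le_trans ltr01).
split; last exact: max_det_chords.
  by move=> _ [y Ky <-] i; rewrite phiE; exact: cP.
pose b (i k : 'I_n) := (1 - th) * `|F i k|.
have b0 i k : 0 <= b i k by rewrite mulr_ge0 //; lra.
have b1 i : \sum_k b i k <= 1.
  rewrite -mulr_sumr; have := width_norm1 nK (wF i).
  by congr (_ * _ <= 1); apply: eq_bigr => k _; rewrite mxE.
have bdet : 1 - kap ^+ n < \sum_(s : 'S_n) \prod_i b i (s i).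
  have det_le : \det F <= \sum_(s : 'S_n) \prod_i `|F i (s i)|.
    apply: ler_sum => s _; apply: (le_trans (ler_norm _)).
    by rewrite normrM normrX normrN1 expr1n mul1r normr_prod.
  have -> : \sum_(s : 'S_n) \prod_i b i (s i) =
      (1 - th) ^+ n * \sum_(s : 'S_n) \prod_i `|F i (s i)|.
    rewrite mulr_sumr; apply: eq_bigr => s _.
    by rewrite big_split /= prodr_const card_ord.
  have bern : forall m, 1 - m%:R * th <= (1 - th) ^+ m.
    elim=> [|m IH]; first by rewrite expr0; lra.
    rewrite exprS -natr1; have : 0 <= m%:R * th by rewrite mulr_ge0.
    move=> h; apply: (@le_trans _ _ ((1 - th) * (1 - m%:R * th))); last by rewrite ler_wpM2l //; lra.
    have := mulr_ge0 h th0; lra.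
  have p0 : 0 <= (1 - th) ^+ n by rewrite exprn_ge0 //; lra.
  have := ler_wpM2l p0 (le_trans dF det_le); rewrite mulr1.
  apply: lt_le_trans; apply: lt_le_trans (bern n); by rewrite ltrD2l ltrN2.
have k1 : kap <= 1 by lra.
have [I_ IP] := choice (fun j => permanent_stable j b0 b1 k0 k1 bdet).
have Iinj : injective I_.
  move=> j j' jj; apply/eqP; apply: contraT => jn.
  have [_ h1] := IP j; have [h2 _] := IP j'.
  have : b (I_ j) j <= \sum_(k | k != j') b (I_ j) k.
    by rewrite (bigD1 j) //= lerDl sumr_ge0.
  by rewrite -jj in h2; lra.
move=> t.
(* The vertex of the old cube at which the new coordinates have the signs t, and
   the opposite vertex. *)
pose t' u : {ffun 'I_n -> bool} := [ffun j => u (+) (t (I_ j) (+) (F (I_ j) j < 0))].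
have low (u : bool) (y : 'rV[R]_n) i : (forall k, 1 - th <= (-1) ^+ t' u k * y 0 k) -> K y ->
    1 - 4 * kap <= (-1) ^+ (u (+) t i) * dot (row i F) y.
  move=> yP Ky; have [j ji] := inj_ord_onto i Iinj.
  have [h1 h2] := IP j; have := yP j; rewrite ffunE !ji in h1 h2 * => h3.
  rewrite mulr_sumr (bigD1 j) //=.
  have e1 : 1 - 2 * kap <= (-1) ^+ (u (+) t i) * (row i F 0 j * y 0 j).
    apply: (le_trans h2); rewrite mxE {1}(mul_sign_norm (F i j)) mulrA mulrA -signr_addb.
    by rewrite -addbA mulrAC /b ler_wpM2r.
  have e2 : - (2 * kap) <= \sum_(k | k != j) (-1) ^+ (u (+) t i) * (row i F 0 k * y 0 k).
    rewrite lerNl -sumrN; apply: (@le_trans _ _ (2 * \sum_(k | k != j) b i k)); last by lra.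
    rewrite mulr_sumr; apply: ler_sum => k _; rewrite -mulrN.
    apply: (le_trans (sign_le_norm _ _)); rewrite normrN mxE normrM /b.
    have := bK y Ky k; have := normr_ge0 (F i k); have := normr_ge0 (y 0 k); nra.
  lra.
have [y Ky yP] := nK (t' false).
have [z Kz zP] := nK (t' true).
exists (y *m F^T + cv); first by exists y.
move=> i; rewrite phiE.
have := low _ _ i yP Ky; have := low _ _ i zP Kz; have := cP i z Kz.
rewrite ler_norml => /andP[] /=.
by case: (t i); rewrite /= ?expr0 ?expr1; lra.
Qed.

(** * Sign vectors with a dominant coordinate *)

Lemma iter_ordS_val n (i : 'I_n) m : val (iter m (@ordS n) i) = ((i + m) %% n)%N.
Proof.
elim: m => [|m IH]; first by rewrite /= addn0 modn_small.
by rewrite iterS [LHS]/= IH -addn1 modnDml addn1 addnS.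
Qed.

Lemma iter_ordS_onto n (i k : 'I_n) : exists m, iter m (@ordS n) i = k.
Proof.
exists (n - i + k)%N; apply: val_inj; rewrite iter_ordS_val addnA subnKC ?(ltnW (ltn_ord i)) //.
by rewrite modnDl modn_small.
Qed.

Lemma cyclic_exit n (M : {set 'I_n}) i k : i \in M -> k \notin M ->
  exists2 j, j \in M & ordS j \notin M.
Proof.
move=> iM kM; apply: contrapT => h; have [m mk] := iter_ordS_onto i k.
move: kM; rewrite -mk => /negP; apply; elim: m {mk} => [//|m IH].
by rewrite iterS; apply: contrapT => /negP h2; apply: h; exists (iter m (@ordS n) i).
Qed.

Lemma ordS_neq n (i : 'I_n) : (1 < n)%N -> ordS i != i.
Proof.
move=> n1; apply/eqP => /(congr1 val) /=.
have := ltn_ord i; rewrite leq_eqVlt => /orP[/eqP e|lt].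
  by rewrite e modnn => e0; move: n1; rewrite -e -e0.
by rewrite modn_small // => /eqP; rewrite -addn1 -[X in _ == X]addn0 eqn_add2l.
Qed.

Lemma ord_pred_neq n (i : 'I_n) : (1 < n)%N -> ord_pred i != i.
Proof.
move=> n1; apply/eqP => h; have := ordS_neq i n1.
by rewrite -[X in ordS X]h ord_predK eqxx.
Qed.

Definition minority n (s : {ffun 'I_n -> bool}) (j : 'I_n) : bool :=
  [forall i, (i != j) ==> (s i != s j)].

(** A sign vector with a single minority sign is labelled by the coordinate before
it, any other one by some coordinate followed by a sign change. Without the
first rule the minority coordinate itself might be the label. The value [i0] is
for constant sign vectors. *)
Definition label n (i0 : 'I_n) (s : {ffun 'I_n -> bool}) : 'I_n :=
  if [pick j | minority s j] is Some j then ord_pred j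
  else if [pick i | s i != s (ordS i)] is Some i then i else i0.

Lemma minority_unique n (s : {ffun 'I_n -> bool}) j k :
  (2 < n)%N -> minority s j -> minority s k -> j = k.
Proof.
move=> n2 /forallP hj /forallP hk; apply/eqP; apply: contraT => jk.
have [l /andP[lj lk]] : exists l, (l != j) && (l != k).
  apply: contrapT => /forallNP h.
  have sub : 'I_n \subset pred2 j k.
    apply/fintype.subsetP => l _; rewrite !inE.
    by have /negP := h l; rewrite negb_and !negbK.
  by have := subset_leq_card sub; rewrite card_ord card2 jk leqNgt n2.
have := hj l; have := hk l; have := hj k; rewrite lj lk eq_sym jk /=.
by case: (s j); case: (s k); case: (s l).
Qed.

Lemma label_minority n (i0 : 'I_n) (s : {ffun 'I_n -> bool}) j :
  (2 < n)%N -> minority s j -> label i0 s = ord_pred j.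
Proof.
move=> n2 mj; rewrite /label; case: pickP => [k mk|/(_ j)]; last by rewrite mj.
by rewrite (minority_unique n2 mk mj).
Qed.

Lemma label_boundary n (i0 : 'I_n) (s : {ffun 'I_n -> bool}) i k :
  (2 < n)%N -> s i != s k -> s (label i0 s) != s (ordS (label i0 s)).
Proof.
move=> n2 ik; rewrite /label; case: pickP => [j /forallP/(_ (ord_pred j))|_].
  by rewrite ord_predK ord_pred_neq // ltnW.
case: pickP => [//|h]; move: ik; have [m <-] := iter_ordS_onto i k.
elim: m => [|m IH]; first by rewrite eqxx.
by rewrite iterS; have /negbFE/eqP <- := h (iter m (@ordS n) i).
Qed.

(** If sigma takes both signs on M, give every coordinate off M the sign of the
next coordinate in M; then sign changes occur only right after elements of M,
and the label has no other choice. If sigma is constant on M, choose j in M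
with its successor off M, and let that successor be the only minority sign. *)
Lemma label_extension n (i0 : 'I_n) (M : {set 'I_n}) (sigma : {ffun 'I_n -> bool}) i k :
  (2 < n)%N -> i \in M -> k \notin M ->
  exists s : {ffun 'I_n -> bool},
    [/\ s != [ffun=> false], forall j, j \in M -> s j = sigma j & label i0 s \in M].
Proof.
move=> n2 iM kM.
have nconst (s : {ffun 'I_n -> bool}) u v : s u != s v -> s != [ffun=> false].
  by move=> uv; apply: contra uv => /eqP ->; rewrite !ffunE.
have [[u [v [uM vM uv]]]|nuv] := pselect (exists u v, [/\ u \in M, v \in M & sigma u != sigma v]).
  have ex j : exists m, iter m (@ordS n) j \in M.
    by have [m mi] := iter_ordS_onto j i; exists m; rewrite mi.
  pose nxt j := iter (ex_minn (ex j)) (@ordS n) j.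
  have nxtM j : j \in M -> nxt j = j.
    move=> jM; rewrite /nxt; case: ex_minnP => m _ /(_ 0%N jM).
    by rewrite leqn0 => /eqP ->.
  have nxtS j : j \notin M -> nxt (ordS j) = nxt j.
    move=> jM; rewrite /nxt; case: ex_minnP => m mM mmin; case: ex_minnP => [[|p] pM pmin].
      by rewrite /= (negbTE jM) in pM.
    rewrite iterSr in pM *; congr (iter _ _ _); apply/eqP; rewrite eqn_leq mmin //=.
    by have := pmin m.+1; rewrite iterSr ltnS; apply.
  pose s : {ffun 'I_n -> bool} := [ffun j => sigma (nxt j)].
  have sM j : j \in M -> s j = sigma j by move=> jM; rewrite ffunE nxtM.
  have suv : s u != s v by rewrite !sM.
  exists s; split=> //; first exact: nconst suv.
  apply: contraT => /nxtS e; have := label_boundary i0 n2 suv.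
  by rewrite !ffunE e eqxx.
have [j jM SjM] := cyclic_exit iM kM.
have sj l : l \in M -> sigma l = sigma j.
  by move=> lM; apply/eqP; apply: contraT => lj; case: nuv; exists l, j.
pose s := flip [ffun=> sigma j] (ordS j).
have n1 : (1 < n)%N by exact: ltnW.
have sS : s (ordS j) = ~~ sigma j by rewrite !ffunE eqxx.
have sN l : l != ordS j -> s l = sigma j by move=> h; rewrite !ffunE (negbTE h).
exists s; split.
- by apply: (nconst _ j (ordS j)); rewrite sS sN ?(eq_sym j) ?ordS_neq //; case: (sigma j).
- move=> l lM; rewrite sN ?sj //; by apply: contra SjM => /eqP <-.
- rewrite (@label_minority _ i0 s (ordS j)) ?ordSK //.
  by apply/forallP => l; apply/implyP => h; rewrite sS (sN _ h); case: (sigma j).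
Qed.

(** * Normals of nearly symmetric bodies *)

Lemma norm_attained (R : realType) n (f : 'rV[R]_n) : f != 0 -> exists i, `|f 0 i| = `|f|.
Proof.
move=> f0; apply: contrapT => /forallNP hn.
have lt k : `|f 0 k| < `|f|.
  by rewrite lt_neqAle coord_le_norm andbT; apply/eqP; exact: hn.
have : `|f| < `|f|.
  rewrite {1}[`|f|]/Num.norm /= mx_normrE; apply/bigmax_ltP; split=> [|[u k] _ /=].
    by rewrite normr_gt0.
  by rewrite (ord1 u); exact: lt.
by rewrite ltxx.
Qed.

Lemma lit_norm_max (R : realType) n (K : set 'rV[R]_n) (d x : 'rV[R]_n) :
  (forall (f : 'rV[R]_n) i, (forall k, `|f 0 k| <= 1) -> `|f 0 i| = 1 -> normal_at K x f -> dot f d < 0) ->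
  lit K d x.
Proof.
move=> h f f0 nf.
have nf0 : 0 < `|f| by rewrite normr_gt0.
have fE k : `|(`|f|^-1 *: f) 0 k| = `|f 0 k| / `|f|.
  by rewrite mxE normrM normfV normr_id mulrC.
have f1 k : `|(`|f|^-1 *: f) 0 k| <= 1 by rewrite fE ler_pdivrMr // mul1r coord_le_norm.
have [i fi] := norm_attained f0.
have := h (`|f|^-1 *: f) i f1; rewrite fE fi divff ?gt_eqF // => /(_ erefl).
rewrite dotZl pmulr_rlt0 ?invr_gt0 //; apply.
by apply: normalZ => //; rewrite invr_ge0 ltW.
Qed.

Lemma symmetric_normal (R : realType) n (K : set 'rV[R]_n) al (x f z : 'rV[R]_n) s p :
  0 <= al -> alpha_symmetric al K -> normal_at K x f -> K z ->
  dot f (signed_perm s p z) <= al * dot f x.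
Proof.
move=> al0 sK nf Kz; have [y Ky <-] := sK z Kz s p.
by rewrite dotZr ler_wpM2l //; exact: nf.
Qed.

Lemma dot_signed_perm (R : realType) n (f z : 'rV[R]_n) s p :
  dot f (signed_perm s p z) = \sum_i f 0 i * ((-1) ^+ s i * z 0 (p i)).
Proof. by apply: eq_bigr => i _; rewrite mxE. Qed.

(** A signed permutation of z puts z_k in place i and gives all terms of the scalar
product a positive sign. *)
Lemma symmetric_support (R : realType) n (K : set 'rV[R]_n) al (x f z : 'rV[R]_n) i k :
  0 <= al -> alpha_symmetric al K -> normal_at K x f -> K z ->
  `|f 0 i| * `|z 0 k| <= al * dot f x.
Proof.
move=> al0 sK nf Kz.
pose p := tperm i k.
apply: le_trans (symmetric_normal (fun i => (f 0 i < 0) (+) (z 0 (p i) < 0)) p al0 sK nf Kz).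
rewrite dot_signed_perm (bigD1 i) //=.
have term l : f 0 l * ((-1) ^+ ((f 0 l < 0) (+) (z 0 (p l) < 0)) * z 0 (p l)) =
    `|f 0 l| * `|z 0 (p l)|.
  by rewrite signr_addb -mulrA signM_norm mulrA (mulrC (f 0 l)) signM_norm.
rewrite term tpermL lerDl; apply: sumr_ge0 => l _; rewrite term; exact: mulr_ge0.
Qed.

(** Compare x with its reflection in the k-th coordinate. *)
Lemma symmetric_normal_sign (R : realType) n (K : set 'rV[R]_n) e (x f : 'rV[R]_n) k :
  0 <= e -> alpha_symmetric (1 + e) K -> normal_at K x f -> K x ->
  - (e * dot f x) <= 2 * (f 0 k * x 0 k).
Proof.
move=> e0 sK nf Kx.
have al0 : 0 <= 1 + e by lra.
have := symmetric_normal (fun i => i == k) 1%g al0 sK nf Kx.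
rewrite dot_signed_perm (bigD1 k) //= eqxx expr1 perm1.
rewrite {2}/dot [X in _ <= _ * X](bigD1 k) //=.
rewrite (eq_bigr (fun i => f 0 i * x 0 i)); last first.
  by move=> i /negbTE ->; rewrite expr0 mul1r perm1.
rewrite /dot [X in - (e * X)](bigD1 k) //=.
lra.
Qed.

(** Compare x with the point in which |x_i| and |x_j| are exchanged, with the sign
of x_i in place i and the sign of f_j in place j. *)
Lemma symmetric_normal_sorted (R : realType) n (K : set 'rV[R]_n) e (x f : 'rV[R]_n) i j :
  0 <= e -> alpha_symmetric (1 + e) K -> normal_at K x f -> K x -> i != j ->
  - (e * dot f x) <=
    ((-1) ^+ (x 0 i < 0)%R * f 0 i - `|f 0 j|) * (`|x 0 i| - `|x 0 j|).
Proof.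
move=> e0 sK nf Kx ij.
have al0 : 0 <= 1 + e by lra.
pose s k := if k == i then (x 0 i < 0) (+) (x 0 j < 0) else
  if k == j then (f 0 j < 0) (+) (x 0 i < 0) else false.
have := symmetric_normal s (tperm i j) al0 sK nf Kx.
rewrite dot_signed_perm (bigD1 i) //= (bigD1 j) 1?eq_sym //=.
rewrite {1 2}/s !eqxx (eq_sym j i) (negbTE ij) tpermL tpermR !signr_addb.
rewrite (eq_bigr (fun k => f 0 k * x 0 k)); last first.
  move=> k /andP[ki kj]; rewrite /s (negbTE ki) (negbTE kj) expr0 mul1r tpermD //.
    by rewrite eq_sym.
  by rewrite eq_sym.
have dE : dot f x = f 0 i * x 0 i + (f 0 j * x 0 j + \sum_(k | (k != i) && (k != j)) f 0 k * x 0 k).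
  by rewrite /dot (bigD1 i) //= (bigD1 j) 1?eq_sym.
have h1 : f 0 j * x 0 j <= `|f 0 j| * `|x 0 j| by rewrite -normrM ler_norm.
have h2 : f 0 i * x 0 i = (-1) ^+ (x 0 i < 0)%R * f 0 i * `|x 0 i|.
  by rewrite {1}(mul_sign_norm (x 0 i)) mulrCA mulrA.
have h3 : f 0 i * ((-1) ^+ (x 0 i < 0)%R * (-1) ^+ (x 0 j < 0)%R * x 0 j) =
  (-1) ^+ (x 0 i < 0)%R * f 0 i * `|x 0 j|.
  by rewrite -[in LHS]mulrA signM_norm mulrCA mulrA.
have h4 : f 0 j * ((-1) ^+ (f 0 j < 0)%R * (-1) ^+ (x 0 i < 0)%R * x 0 i) =
  `|f 0 j| * `|x 0 i|.
  by rewrite -[in LHS]mulrA signM_norm mulrA (mulrC (f 0 j)) signM_norm.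
rewrite h3 h4; move: h1; rewrite dE h2.
move: ((-1) ^+ (x 0 i < 0)%R * f 0 i) (\sum_(k | _) _) (f 0 j * x 0 j) (`|f 0 j|).
move: (`|x 0 i|) (`|x 0 j|); clear; move=> a b F S c u; lra.
Qed.

(** Among the n + 1 nested level sets at heights u_max - k g, k = 0, ..., n, all
nonempty, two consecutive ones coincide. *)
Lemma gap_set (R : realType) n (u : 'I_n -> R) i1 (g : R) :
  (forall i, u i <= u i1) -> 0 < g ->
  exists M : {set 'I_n}, [/\ i1 \in M, forall i, i \in M -> u i1 - n%:R * g <= u i &
    forall i j, i \in M -> j \notin M -> g <= u i - u j].
Proof.
move=> umax g0.
pose M k := [set i | u i1 - k%:R * g <= u i]%SET.
have sub k : M k \subset M k.+1.
  apply/fintype.subsetP => i; rewrite !inE; apply: le_trans.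
  by rewrite lerD2l lerN2 ler_pM2r // ler_nat.
have [k [kn Mk]] : exists k, (k < n)%N /\ M k = M k.+1.
  apply: contrapT => /forallNP h.
  have card k : (k <= n)%N -> (k < #|M k|)%N.
    elim: k => [_|k IH kn].
      by rewrite card_gt0; apply/set0Pn; exists i1; rewrite inE mul0r subr0.
    apply: (leq_ltn_trans (IH (ltnW kn))); apply: proper_card.
    rewrite finset.properEneq sub andbT; apply/eqP => e; exact: (h k).
  by have := card n (leqnn n); rewrite ltnNge -[X in (_ <= X)%N]card_ord max_card.
exists (M k); split.
- by rewrite inE gerBl mulr_ge0 // ltW.
- move=> i; rewrite inE; apply: le_trans.
  by rewrite lerD2l lerN2 ler_pM2r // ler_nat ltnW.
- move=> i j; rewrite inE Mk inE -ltNge => h1 h2.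
  move: h2; rewrite -natr1; lra.
Qed.

(** A normal at x of an exactly symmetric body has this property with ep = 0 if x is
nonzero on M and |x_i| > |x_j| whenever i is in M and j is not. *)
Definition almost_sorted (R : realType) n (ep : R) (M : {set 'I_n}) (x f : 'rV[R]_n) : Prop :=
  (forall i, i \in M -> - ep <= (-1) ^+ sgn x i * f 0 i) /\
  (forall i j, i \in M -> j \notin M -> `|f 0 j| <= (-1) ^+ sgn x i * f 0 i + ep).

(** The bounds of [symmetric_normal_sign] and [symmetric_normal_sorted], divided by
|x_i| and by |x_i| - |x_j|, both of which are at least g. *)
Lemma normal_almost_sorted (R : realType) n (K : set 'rV[R]_n) (e ep g : R) (z x f : 'rV[R]_n)
    (M : {set 'I_n}) j1 i1 i2 :
  in_cube K -> alpha_symmetric (1 + e) K -> K z -> `|z 0 j1| = 1 ->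
  K x -> normal_at K x f -> (forall i, `|f 0 i| <= 1) -> `|f 0 i1| = 1 ->
  0 <= e -> e <= 1 -> 0 < g -> n%:R * e <= ep * g -> 4 * (n%:R * (n%:R * g)) <= 1 ->
  (forall i, `|x 0 i| <= `|x 0 i2|) ->
  (forall i, i \in M -> `|x 0 i2| - n%:R * g <= `|x 0 i|) ->
  (forall i j, i \in M -> j \notin M -> g <= `|x 0 i| - `|x 0 j|) ->
  almost_sorted ep M x f.
Proof.
move=> bK sK Kz z1 Kx nf f1 fi1 e0 e1 g0 eg ng umax Mlow Mgap.
have n1 : 1 <= n%:R :> R by rewrite ler1n; apply: leq_ltn_trans (ltn_ord i1).
set a := `|x 0 i2| in umax Mlow *.
have a1 : a <= 1 by exact: bK.
have h1 : 1 <= (1 + e) * dot f x.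
  have al0 : 0 <= 1 + e by lra.
  by have := symmetric_support i1 j1 al0 sK nf Kz; rewrite fi1 z1 mulr1.
have h2 : dot f x <= n%:R * a.
  rewrite -[X in X%:R * a](card_ord n) -sum1_card natr_sum mulr_suml; apply: ler_sum => i _.
  rewrite mul1r; apply: (le_trans (ler_norm _)); rewrite normrM -[leRHS]mul1r.
  exact: ler_pM.
have h0 : 0 <= dot f x.
  rewrite leNgt; apply/negP => h; have := mulr_ge0 e0 e0; nra.
have edot : e * dot f x <= ep * g.
  apply: le_trans eg; rewrite mulrC ler_wpM2r //; apply: (le_trans h2).
  by rewrite -[leRHS]mulr1 ler_wpM2l.
have ag : (n%:R + 1) * g <= a.
  have : 1 <= 2 * (n%:R * a).
    apply: (le_trans h1); apply: (le_trans (ler_wpM2r h0 (_ : 1 + e <= 2))); first lra.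
    by rewrite ler_wpM2l.
  have ngg : g <= n%:R * g by rewrite -[leLHS]mul1r ler_wpM2r // ltW.
  have : n%:R * g <= n%:R * (n%:R * g) by rewrite ler_wpM2l // ler0n.
  move=> h3 h4; rewrite leNgt; apply/negP => hlt.
  have : n%:R * a < n%:R * ((n%:R + 1) * g) by rewrite ltr_pM2l //; lra.
  lra.
have sx i : (-1) ^+ sgn x i * f 0 i = (-1) ^+ (x 0 i < 0)%R * f 0 i by rewrite ffunE.
split=> [i iM|i j iM jM]; rewrite sx.
  have xi : g <= `|x 0 i| by have := Mlow i iM; lra.
  have := symmetric_normal_sign i e0 sK nf Kx.
  have -> : f 0 i * x 0 i = (-1) ^+ (x 0 i < 0)%R * f 0 i * `|x 0 i|.
    by rewrite {1}(mul_sign_norm (x 0 i)) mulrCA mulrA.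
  move: ((-1) ^+ _ * f 0 i) => F hF; rewrite leNgt; apply/negP => hep.
  have ep0 : 0 <= ep by rewrite -(pmulr_lge0 _ g0) (le_trans _ eg) // mulr_ge0.
  have : F * `|x 0 i| <= F * g by rewrite ler_wnM2l //; lra.
  have : F * g < - ep * g by rewrite ltr_pM2r.
  have := mulr_ge0 ep0 (ltW g0); lra.
have ij : i != j by apply: contraNneq jM => <-.
have := symmetric_normal_sorted e0 sK nf Kx ij.
have := Mgap i j iM jM.
move: ((-1) ^+ _ * f 0 i) (`|x 0 i| - `|x 0 j|) => F u gu hF; rewrite leNgt; apply/negP => hep.
have ep0 : 0 <= ep by rewrite -(pmulr_lge0 _ g0) (le_trans _ eg) // mulr_ge0.
have : (F - `|f 0 j|) * u <= (F - `|f 0 j|) * g by rewrite ler_wnM2l //; lra.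
have : (F - `|f 0 j|) * g < - ep * g by rewrite ltr_pM2r //; lra.
lra.
Qed.

(** * Nearly symmetric bodies away from the cube *)

(** Let phi be the coordinate of f at the label l, with the sign of x. The wrong
signs occur off M, where |f| is at most phi + ep, and have total weight at most
1/2; so the scalar product is at most - phi / 2 up to an error of order n ep. If the
largest coordinate i1 of f is l or lies off M then phi is close to 1; otherwise
phi may vanish, but i1 contributes - eta. *)
Lemma weighted_dir_neg (R : realType) n (M : {set 'I_n}) (x f : 'rV[R]_n)
    (t : {ffun 'I_n -> bool}) (w : 'I_n -> R) (l i1 : 'I_n) (om eta ep : R) :
  almost_sorted ep M x f -> (forall i, `|f 0 i| <= 1) -> `|f 0 i1| = 1 ->
  l \in M -> (forall i, i \in M -> t i = sgn x i) ->
  w l = 1 -> (forall i, eta <= w i) -> (forall i, i != l -> w i <= om) ->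
  0 <= ep -> 0 <= om -> 2 * (n%:R * om) <= 1 -> (n%:R + 2) * ep < eta -> eta <= 1 / 4 ->
  dot f (\row_i (- ((-1) ^+ t i * w i))) < 0.
Proof.
move=> [fM fN] f1 fi1 lM tM wl we wo ep0 om0 Nom Nep eta2.
have N1 : 1 <= n%:R :> R by rewrite ler1n; apply: leq_ltn_trans (ltn_ord i1).
have Nep0 : 0 <= n%:R * ep by rewrite mulr_ge0.
pose phi := (-1) ^+ sgn x l * f 0 l.
have phi0 : - ep <= phi by exact: fM.
have om1 : om <= 1 by have := ler_wpM2r om0 N1; lra.
have w1 i : w i <= 1.
  by have [->|il] := eqVneq i l; [rewrite wl|exact: le_trans (wo i il) om1].
have w0 i : 0 <= w i by have := we i; lra.
pose B := om * (phi + ep) + ep.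
have B0 : 0 <= B by rewrite addr_ge0 // mulr_ge0 //; lra.
have term i : i != l -> f 0 i * (- ((-1) ^+ t i * w i)) <= B.
  move=> il; have [iM|iM] := boolP (i \in M).
    rewrite tM // (_ : _ * _ = w i * - ((-1) ^+ sgn x i * f 0 i)); last by ring.
    apply: (@le_trans _ _ (w i * ep)); first by rewrite ler_wpM2l // lerNl; exact: fM.
    apply: (@le_trans _ _ (1 * ep)); first by rewrite ler_wpM2r.
    by rewrite mul1r lerDr mulr_ge0 //; lra.
  rewrite (_ : _ * _ = w i * ((-1) ^+ t i * - f 0 i)); last by ring.
  apply: (@le_trans _ _ (w i * `|f 0 i|)).
    by rewrite ler_wpM2l // (le_trans (sign_le_norm _ _)) // normrN.
  apply: (@le_trans _ _ (om * (phi + ep))); last by rewrite lerDl.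
  by apply: ler_pM => //; [exact: wo|exact: fN].
have sumB : \sum_(i < n | i != l) B <= n%:R * B.
  rewrite -[n in n%:R]card_ord -sum1_card natr_sum mulr_suml [leRHS](bigD1 l) //= mul1r.
  by rewrite -[leLHS]add0r lerD //; apply: ler_sum => i _; rewrite mul1r.
have NB : n%:R * B <= (phi + ep) / 2 + n%:R * ep.
  have : n%:R * om * (phi + ep) <= 1 / 2 * (phi + ep) by rewrite ler_wpM2r //; lra.
  rewrite /B; lra.
(* [c] is the gain from the coordinate i1, either 0 or eta. *)
have main (c : R) : \sum_(i < n | i != l) f 0 i * (- ((-1) ^+ t i * w i)) <= n%:R * B - c ->
    (phi + ep) / 2 + n%:R * ep - c < phi -> dot f (\row_i (- ((-1) ^+ t i * w i))) < 0.
  move=> hc hphi; rewrite /dot (bigD1 l) //= mxE wl tM //.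
  rewrite (_ : \sum_(i < n | i != l) _ = \sum_(i < n | i != l) f 0 i * (- ((-1) ^+ t i * w i))); last first.
    by apply: eq_bigr => i _; rewrite mxE.
  rewrite (_ : f 0 l * _ = - phi); last by rewrite /phi; ring.
  lra.
have main0 : 1 / 2 <= phi -> dot f (\row_i (- ((-1) ^+ t i * w i))) < 0.
  move=> h; apply: (main 0); last by lra.
  by rewrite subr0; apply: le_trans sumB; apply: ler_sum => i; exact: term.
have [i1M|i1M] := boolP (i1 \in M); last first.
  by apply: main0; have : `|f 0 i1| <= phi + ep := fN l i1 lM i1M; rewrite fi1; lra.
have f'1 : (-1) ^+ sgn x i1 * f 0 i1 = 1.
  have := fM i1 i1M; move: fi1; rewrite -(norm_sign (sgn x i1)).
  by case: (ltrP ((-1) ^+ sgn x i1 * f 0 i1) 0) => h; rewrite ?(ltr0_norm h) ?(ger0_norm h) //; lra.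
have [i1l|i1l] := eqVneq i1 l; first by apply: main0; rewrite /phi -i1l f'1; lra.
apply: (main eta); last by lra.
rewrite (bigD1 i1) //=.
have -> : f 0 i1 * (- ((-1) ^+ t i1 * w i1)) = - w i1.
  by rewrite tM // mulrN mulrA (mulrC (f 0 i1)) f'1 mul1r.
have : \sum_(i < n | (i != l) && (i != i1)) f 0 i * (- ((-1) ^+ t i * w i)) <= n%:R * B.
  apply: le_trans sumB; rewrite [leRHS](bigD1 i1) //= -[leLHS]add0r lerD //.
  by apply: ler_sum => i /andP[il _]; exact: term.
by have := we i1; lra.
Qed.

(** If the sum S of the coordinates of f off k0 were small then f would nearly be
the k0-th coordinate form, and f.x would be nearly x_k0 <= 1 - theta / 2; but
f.x is not much smaller than 1. So S is at least theta / 4, and the small weight eta at k0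
cannot compensate - om S. *)
Lemma near_vertex_neg (R : realType) n (x f : 'rV[R]_n) (w : 'I_n -> R)
    (k0 i1 : 'I_n) (a th om eta ep : R) :
  (forall i, - ep <= f 0 i) -> (forall i, `|f 0 i| <= 1) -> `|f 0 i1| = 1 ->
  (forall i, 0 <= x 0 i <= a) -> a <= 1 - th / 2 -> 1 - ep <= dot f x ->
  w k0 = eta -> (forall i, i != k0 -> om <= w i) -> (forall i, i != k0 -> w i <= 1) ->
  0 <= ep -> 0 < th -> th <= 1 -> 8 * eta = om * th -> 0 < om -> om <= 1 -> (n%:R + 2) * ep < eta ->
  dot f (\row_i (- ((-1) ^+ (i == k0) * w i))) < 0.
Proof.
move=> fe f1 fi1 xa ath fx wk wo w1 ep0 th0 th1 eta8 om0 om1 Nep.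
pose S := \sum_(i < n | i != k0) f 0 i.
have Nep0 : 0 <= n%:R * ep by rewrite mulr_ge0.
have sumep : \sum_(i < n | i != k0) ep <= n%:R * ep.
  rewrite -[n in n%:R]card_ord -sum1_card natr_sum mulr_suml [leRHS](bigD1 k0) //= mul1r.
  by rewrite -[leLHS]add0r lerD //; apply: ler_sum => i _; rewrite mul1r.
have eta1 : eta <= th / 8 by have := ler_wpM2r (ltW th0) om1; lra.
have Sge : th / 4 <= S.
  have [i1k|i1k] := eqVneq i1 k0; last first.
    have f'1 : f 0 i1 = 1.
      have := fe i1; move: fi1.
      by case: (ltrP (f 0 i1) 0) => h; rewrite ?(ltr0_norm h) ?(ger0_norm h) //; lra.
    have : - (n%:R * ep) <= \sum_(i < n | (i != k0) && (i != i1)) f 0 i.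
      rewrite lerNl -sumrN; apply: le_trans sumep.
      rewrite [leRHS](bigD1 i1) //= -[leLHS]add0r lerD //.
      by apply: ler_sum => i _; rewrite lerNl.
    by move=> hs; rewrite /S (bigD1 i1) //= f'1; lra.
  have : dot f x <= (1 - th / 2) + (S + \sum_(i < n | i != k0) ep).
    rewrite /dot (bigD1 k0) //= /S -big_split /=; apply: lerD.
      have /andP[x0 xa0] := xa k0; apply: le_trans ath; apply: le_trans xa0.
      rewrite -[leRHS]mul1r; apply: ler_wpM2r => //.
      by apply: le_trans (f1 k0); exact: ler_norm.
    apply: ler_sum => i _; have /andP[x0 xa0] := xa i.
    apply: (@le_trans _ _ ((f 0 i + ep) * x 0 i)).
      by rewrite mulrDl lerDl mulr_ge0.
    by rewrite -[leRHS]mulr1 ler_wpM2l //; [have := fe i; lra|lra].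
  lra.
rewrite /dot (bigD1 k0) //= mxE eqxx expr1 wk.
have rest : \sum_(i < n | i != k0) f 0 i * (\row_i0 (- ((-1) ^+ (i0 == k0) * w i0))) 0 i <=
    - (om * S) + \sum_(i < n | i != k0) ep.
  rewrite /S mulr_sumr -sumrN -big_split /=; apply: ler_sum => i ik.
  rewrite mxE (negbTE ik) expr0 mul1r.
  have h1 := wo i ik; have h2 := w1 i ik; have h3 := fe i.
  have : (w i - om) * - ep <= (w i - om) * f 0 i by rewrite ler_wpM2l //; lra.
  have : (w i - om) * ep <= 1 * ep by rewrite ler_wpM2r //; lra.
  lra.
have fk : f 0 k0 <= 1 by apply: le_trans (f1 k0); exact: ler_norm.
have eta0 : 0 < eta by lra.
have : f 0 k0 * eta <= 1 * eta by rewrite ler_wpM2r // ltW.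
have : om * (th / 4) <= om * S by rewrite ler_wpM2l // ltW.
lra.
Qed.

(** The parameters, in the order of choice: om = 1/(2n) is the weight off the label,
eta of order theta/n the weight at the minus sign of the neighbour of (+,...,+),
ep the tolerated error of normals, g the gap, and e0 = ep g / n. *)
Lemma far_from_cube_spares (R : realType) n (th : R) :
  (2 < n)%N -> 0 < th -> th <= 1 ->
  exists2 e0 : R, 0 < e0 & forall (e : R) (K : set 'rV[R]_n) z j1,
    0 <= e -> e <= e0 -> in_cube K -> alpha_symmetric (1 + e) K -> K z -> `|z 0 j1| = 1 ->
    (forall x, K x -> exists i, x 0 i < 1 - th) -> spares_direction K.
Proof.
move=> n2 th0 th1.
pose N : R := n%:R.
have N1 : 1 <= N by rewrite ler1n; apply: leq_trans n2.
have N0 : 0 < N by exact: lt_le_trans N1.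
have [om [om0 Nom om1]] : exists om : R, [/\ 0 < om, 2 * (N * om) = 1 & om <= 1 / 2].
  exists (1 / (2 * N)); split.
  - by rewrite divr_gt0 // mulr_gt0.
  - by field; rewrite gt_eqF.
  - by rewrite ler_pdivrMr ?mulr_gt0 //; lra.
have [eta [eta0 eta8]] : exists eta : R, 0 < eta /\ 8 * eta = om * th.
  by exists (om * th / 8); split; [rewrite divr_gt0 // mulr_gt0|lra].
have etao : 8 * eta <= om by rewrite eta8 -[leRHS]mulr1 ler_wpM2l // ltW.
have [ep [ep0 Nep]] : exists ep : R, 0 < ep /\ (N + 2) * ep < eta.
  exists (eta / (N + 3)); split; first by rewrite divr_gt0 //; lra.
  by rewrite mulrA ltr_pdivrMr; lra.
have [g [g0 gth]] : exists g : R, 0 < g /\ 4 * (N * (N * g)) <= th.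
  exists (th / (4 * (N * N))); split; first by rewrite divr_gt0 // !mulr_gt0.
  rewrite (_ : 4 * _ = th) //; field; rewrite gt_eqF //.
have gN : N * g <= th / 4.
  have : N * g <= N * (N * g) by rewrite -[leLHS]mul1r ler_wpM2r // mulr_ge0 ?ltW.
  lra.
have gle : g <= N * g by rewrite -[leLHS]mul1r ler_wpM2r // ltW.
exists (ep * g / N); first by rewrite divr_gt0 // mulr_gt0.
move=> e K z j1 e0; rewrite ler_pdivlMr // mulrC => eg bK sK Kz z1 far.
have eep : e <= ep.
  have : e <= N * e by rewrite -[leLHS]mul1r ler_wpM2r.
  have : ep * g <= ep * 1 by rewrite ler_wpM2l ?(ltW ep0) //; lra.
  lra.
have Nep0 : 0 <= N * ep by rewrite mulr_ge0 // ltW.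
have e1 : e <= 1 by lra.
pose k0 := j1; pose t0 : {ffun 'I_n -> bool} := [ffun=> false].
pose w (t : {ffun 'I_n -> bool}) i : R :=
  if i == label k0 t then 1 else if (t == flip t0 k0) && (i == k0) then eta else om.
pose d (t : {ffun 'I_n -> bool}) : 'rV[R]_n := \row_i (- ((-1) ^+ t i * w t i)).
have wl t : w t (label k0 t) = 1 by rewrite /w eqxx.
have we t i : eta <= w t i by rewrite /w; case: ifP => _; [lra|case: ifP => _; lra].
have wo t i : i != label k0 t -> w t i <= om.
  by rewrite /w => /negbTE ->; case: ifP => _; lra.
exists t0, d => x Kx.
have [i2 umax] : exists i2, forall i, `|x 0 i| <= `|x 0 i2|.
  have [i _ hi] := @Order.TotalTheory.arg_maxP _ _ _ j1 predT (fun i => `|x 0 i|) isT.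
  by exists i => k; exact: hi.
have [M [i2M]] := @gap_set R n (fun i => `|x 0 i|) i2 g umax g0.
rewrite /= => Mlow Mgap.
have sorted f i1 : normal_at K x f -> (forall i, `|f 0 i| <= 1) -> `|f 0 i1| = 1 ->
    almost_sorted ep M x f.
  move=> nf f1 fi1.
  by apply: (normal_almost_sorted bK sK Kz z1 Kx nf f1 fi1 e0 e1 g0 eg _ umax Mlow Mgap); rewrite -/N; lra.
have generic t : label k0 t \in M -> (forall i, i \in M -> t i = sgn x i) -> lit K (d t) x.
  move=> lM tM; apply: lit_norm_max => f i1 f1 fi1 nf.
  by apply: (weighted_dir_neg (sorted f i1 nf f1 fi1) f1 fi1 lM tM (wl t) (we t) (wo t));
    rewrite -/N //; lra.
have [[k kM]|Mfull] := pselect (exists k, k \notin M).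
  have [t [tt0 tM lM]] := label_extension k0 (sgn x) n2 i2M kM.
  by exists t => //; exact: generic.
have MT i : i \in M by apply: contraT => iM; case: Mfull; exists i.
have [xt0|xt0] := eqVneq (sgn x) t0; last by exists (sgn x) => //; exact: generic.
exists (flip t0 k0); first exact: flip_neq.
apply: lit_norm_max => f i1 f1 fi1 nf.
have -> : d (flip t0 k0) = \row_i (- ((-1) ^+ (i == k0) * w (flip t0 k0) i)).
  by apply/rowP => i; rewrite !mxE !ffunE; case: eqP.
have lk : label k0 (flip t0 k0) = ord_pred k0.
  apply: label_minority => //; apply/forallP => l; apply/implyP => lk.
  by rewrite !ffunE eqxx (negbTE lk).
have [fM _] := sorted f i1 nf f1 fi1.
have fe i : - ep <= f 0 i by have := fM i (MT i); rewrite xt0 ffunE expr0 mul1r.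
have xa i : 0 <= x 0 i <= `|x 0 i2|.
  have := umax i; have /ffunP/(_ i) := xt0; rewrite !ffunE => /negbT; rewrite -leNgt => x0.
  by rewrite x0 /= ger0_norm.
have ath : `|x 0 i2| <= 1 - th / 2.
  have [i xi] := far x Kx; have := Mlow i (MT i); have /andP[x0 _] := xa i.
  by rewrite (ger0_norm x0) -/N; lra.
have fx : 1 - ep <= dot f x.
  have al0 : 0 <= 1 + e by lra.
  have := symmetric_support i1 j1 al0 sK nf Kz; rewrite fi1 z1 mulr1 => h.
  have : (1 - e) * 1 <= (1 - e) * ((1 + e) * dot f x) by rewrite ler_wpM2l //; lra.
  have d0 : 0 <= dot f x.
    by rewrite -(pmulr_rge0 _ (_ : 0 < 1 + e)); lra.
  have := mulr_ge0 (mulr_ge0 e0 e0) d0; lra.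
apply: (near_vertex_neg fe f1 fi1 xa ath fx _ _ _ (ltW ep0) th0 th1 eta8 om0) => //.
- by rewrite /w lk eq_sym (negbTE (ord_pred_neq _ _)) ?eqxx // ltnW.
- by move=> i ik; rewrite /w (negbTE ik) andbF; case: ifP => _; lra.
- by move=> i ik; rewrite /w (negbTE ik) andbF; case: ifP => _; lra.
- by lra.
Qed.

(** * Nearly symmetric bodies in general *)

Lemma near_cube_spares (R : realType) n : (0 < n)%N ->
  exists th : R, [/\ 0 < th, th <= 1 / 2 & forall K : set 'rV[R]_n,
    compact K -> convex_set K -> in_cube K -> near_cube K th ->
    spares_direction K \/ parallelepiped K].
Proof.
move=> n0.
(* 8 * kap is the closeness to the cube that [chords_spares] requires. *)
have [kap [k0 k8 kb]] : exists kap : R, [/\ 0 < kap, kap < 1 / 8 &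
    8 * ((386 + 386 / 2 + 12) * (8 * kap)) <= 1].
  by exists (1 / (200 * 200)); split; lra.
have N1 : 1 <= n%:R :> R by rewrite ler1n.
have N0 : 0 < n%:R :> R by exact: lt_le_trans N1.
have kn0 : 0 < kap ^+ n by rewrite exprn_gt0.
have kn1 : kap ^+ n <= 1 by rewrite exprn_ile1 // ltW //; lra.
pose th := kap ^+ n / (2 * n%:R).
have thn : n%:R * th = kap ^+ n / 2 by rewrite /th; field; rewrite gt_eqF.
have th0 : 0 < th by rewrite divr_gt0 // mulr_gt0.
have th2 : th <= 1 / 2.
  have : 1 * th <= n%:R * th by rewrite ler_wpM2r // ltW.
  by rewrite thn mul1r; lra.
exists th; split=> // K cK vK bK nK.
have thk : n%:R * th < kap ^+ n by rewrite thn; lra.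
have [A [c [uA [bK' nK' hK']]]] := chords_position cK vK bK nK k0 k8 (ltW th0) th2 thk.
set K' := [set x *m A + c | x in K] in bK' nK' hK' *.
have KK' : affinely_equivalent K K' by apply: affine_sym; exists A, c.
have [Kc|Kc] := pselect (K' = @cube R n); first by right; rewrite /parallelepiped -Kc.
left; apply: (spares_direction_affine KK').
have a0 : 0 < 8 * kap by lra.
exact: (chords_spares (affine_compact cK) (affine_convex vK) bK' a0 nK' kb hK' Kc).
Qed.

(** If the largest norm were 0 then the body would be a point. *)
Lemma convex_body_norm (R : realType) n (L : set 'rV[R]_n) :
  (0 < n)%N -> convex_body L ->
  exists z, [/\ L z, z != 0 & forall x, L x -> `|x| <= `|z|].
Proof.
move=> n0 [cL _ [u iu]].
have Lu : L u by exact: interior_subset iu.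
have [z + zmax] := EVT_max_rV (ex_intro _ u Lu) cL (continuous_subspaceT (@norm_continuous R 'rV[R]_n)).
rewrite inE => Lz; exists z; split=> //; last first.
  by move=> x Lx; apply: zmax; rewrite inE.
apply/eqP => z00.
have L0 x : L x -> x = 0.
  move=> Lx; apply/eqP; rewrite -normr_le0.
  by have := zmax x; rewrite inE => /(_ Lx); rewrite z00 normr0.
have := interior_normal0 iu (f := const_mx 1).
have n_normal : normal_at L u (const_mx 1) by move=> y /L0 ->; rewrite (L0 u Lu).
move=> /(_ n_normal)/rowP/(_ (Ordinal n0)); rewrite !mxE => /eqP.
by rewrite oner_eq0.
Qed.

(** Scaled to touch the cube, the body either has no point with all coordinates
above 1 - theta, or the signed copies of such a point come close to all vertices
of the cube. *)
Lemma symmetric_spares (R : realType) n : (2 < n)%N ->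
  exists2 al : R, 1 < al & forall L : set 'rV[R]_n,
    convex_body L -> alpha_symmetric al L -> spares_direction L \/ parallelepiped L.
Proof.
move=> n2; have n0 : (0 < n)%N by exact: leq_trans n2.
have [th1 [th10 th12 nearP]] := near_cube_spares R n0.
pose th := th1 / 2.
have th0 : 0 < th by rewrite /th; lra.
have th1' : th <= 1 by rewrite /th; lra.
have [e0 e00 farP] := far_from_cube_spares n2 th0 th1'.
pose e := Num.min e0 th.
have ep : 0 < e by rewrite lt_min e00.
have ee0 : e <= e0 by rewrite ge_min lexx.
have eth : e <= th by rewrite ge_min lexx orbT.
exists (1 + e); first by lra.
move=> L cL sL; have [z [Lz z0 zmax]] := convex_body_norm n0 cL.
have [compL vL _] := cL.
have m0 : 0 < `|z| by rewrite normr_gt0.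
pose A : 'M[R]_n := (`|z|^-1)%:M.
have uA : A \in unitmx by rewrite unitmxE det_scalar unitrX // unitfE invr_neq0 // gt_eqF.
pose K := [set x *m A + 0 | x in L].
have KE x : x *m A + 0 = `|z|^-1 *: x by rewrite addr0 mul_mx_scalar.
have LK : affinely_equivalent L K by apply: affine_sym; exists A, 0.
suff [iK|pK] : spares_direction K \/ parallelepiped K.
- by left; exact: (spares_direction_affine LK).
- by right; exact: (affine_trans LK pK).
have cK : compact K by exact: affine_compact.
have vK : convex_set K by exact: affine_convex.
have bK : in_cube K.
  move=> _ [x Lx <-] i; rewrite KE mxE normrM normfV normr_id mulrC ler_pdivrMr // mul1r.
  by apply: (le_trans (coord_le_norm _ _)); exact: zmax.
have sK : alpha_symmetric (1 + e) K.
  move=> _ [x Lx <-] s p; have [y Ly yx] := sL x Lx s p.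
  exists (y *m A + 0); first by exists y.
  rewrite !KE scalerA mulrC -scalerA yx; apply/rowP => i; rewrite !mxE; ring.
have [farK|nfar] := pselect (forall x, K x -> exists i, x 0 i < 1 - th).
  have [j zj] := norm_attained z0.
  have Kz : K (z *m A + 0) by exists z.
  left; apply: (farP e K _ j (ltW ep) ee0 bK sK Kz _ farK).
  by rewrite KE mxE normrM normfV normr_id zj mulVf // gt_eqF.
apply: nearP => // t.
have [x [Kx xP]] : exists x, K x /\ forall i, 1 - th <= x 0 i.
  apply: contrapT => h; apply: nfar => x Kx; apply: contrapT => h2; apply: h.
  exists x; split=> // i; rewrite leNgt; apply/negP => h3; apply: h2; by exists i.
have [y Ky yx] := sK x Kx t 1%g.
exists y => // i; have := xP i; move/rowP: yx => /(_ i); rewrite !mxE perm1 => yx.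
have -> : x 0 i = (1 + e) * ((-1) ^+ t i * y 0 i).
  by rewrite mulrCA yx mulrA -expr2 sqrr_sign mul1r.
move=> h; rewrite -(ler_pM2l (_ : 0 < 1 + e)); last by lra.
apply: le_trans h; have := mulr_ge0 (ltW ep) (ltW th10); rewrite /th in eth *; lra.
Qed.

Theorem theorem30 (R : realType) (n : nat) (hn : (3 <= n)%N) :
  exists alpha : R, 1 < alpha /\
    forall K : set 'rV[R]_n,
      convex_body K ->
      (alpha_symmetric alpha K \/
       exists L : set 'rV[R]_n,
         [/\ convex_body L, alpha_symmetric alpha L & affinely_equivalent K L]) ->
      (~ parallelepiped K -> (illumination_number K <= (2 ^+ n - 1)%:E)%E) /\
      (parallelepiped K -> illumination_number K = (2 ^+ n)%:E).
Proof.
have [al al1 alP] := symmetric_spares R hn.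
exists al; split=> // K cK sK.
split=> [npK|pK]; last first.
  apply/le_anti; rewrite parallelepiped_number_le //=.
  by apply: parallelepiped_number_ge => //; exact: leq_trans hn.
apply: spares_direction_number => //; case: sK => [sK|[L [cL sL KL]]].
  by have [] := alP K cK sK.
have [iL|pL] := alP L cL sL; first exact: (spares_direction_affine KL).
by case: npK; exact: (affine_trans KL pL).
Qed.
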